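(* Let $N\ge1$ and $d\ge1+2N$. Let $\mathcal{R}^1_\infty,\dots,\mathcal{R}^N_\infty$ be $N$ independent simple random walk ranges in $\mathbb{Z}^d$. There exists a positive constant $C$ such that for any finite set $A\subset\mathbb{Z}^d$ containing the origin, and any $z\in\mathbb{Z}^d\setminus\{0\}$ with $\|z\|\ge2\cdot\mathrm{diam}(A)$, $$\frac1C\cdot\frac{\mathrm{Cap}_{d-2N}(A)}{\|z\|^{d-2N}}\le\mathbb{P}\Big((z+\mathcal{R}_\infty^1+\dots+\mathcal{R}_\infty^N)\cap A\ne\emptyset\Big)\le C\cdot\frac{\mathrm{Cap}_{d-2N}(A)}{\|z\|^{d-2N}}.$$
   Context: Simple random walk on $\mathbb{Z}^d$: started from the origin, i.i.d. increments uniform on the $2d$ neighbours of the origin; its range is $\mathcal{R}_\infty=\{X_n:n\ge0\}$. Sums of sets are Minkowski sums, $A+B=\{a+b:a\in A,b\in B\}$. $\|\cdot\|$ is the Euclidean norm and $\mathrm{diam}(A)=\max_{x,y\in A}\|x-y\|$. For $\gamma>0$ and a finite nonempty $A\subset\mathbb{Z}^d$, the $\gamma$-capacity is defined by $$\frac1{\mathrm{Cap}_\gamma(A)}=\inf\Big\{\sum_{x,y\in A}(1+\|x-y\|)^{-\gamma}\nu(x)\nu(y):\ \nu\text{ probability measure on }A\Big\}.$$ *)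

(* Defs.v *)
From HB Require Import structures.
From mathcomp Require Import all_boot all_order all_algebra.
From mathcomp Require Import finmap.
From mathcomp Require Import all_classical all_reals all_analysis.

Set Implicit Arguments.
Unset Strict Implicit.
Unset Printing Implicit Defensive.

Import Order.TTheory GRing.Theory Num.Theory.

Local Open Scope classical_set_scope.
Local Open Scope ring_scope.

Notation Zd d := 'rV[int]_d.

Section Geometry.
Context {R : realType} {d : nat}.

Definition enorm (x : Zd d) : R :=
  Num.sqrt (\sum_(i < d) ((x ord0 i)%:~R ^+ 2)).

(* The default value 0 of the maximum is harmless: norms are nonnegative. *)
Definition diam (A : {fset Zd d}) : R :=
  \big[Num.max/0]_(x <- A) \big[Num.max/0]_(y <- A) enorm (x - y).

(* Only the values of [nu] on [A] matter. *)
Definition probability_on (A : {fset Zd d}) (nu : Zd d -> R) : Prop :=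
  (forall x, x \in A -> 0 <= nu x) /\ \sum_(x <- A) nu x = 1.

Definition energy (gamma : R) (A : {fset Zd d}) (nu : Zd d -> R) : R :=
  \sum_(x <- A) \sum_(y <- A) (1 + enorm (x - y)) `^ (- gamma) * nu x * nu y.

Definition capacity (gamma : R) (A : {fset Zd d}) : R :=
  (inf [set energy gamma A nu | nu in probability_on A])^-1.

End Geometry.

Definition minkowski_sum {V : nmodType} (A B : set V) : set V :=
  [set a + b | a in A & b in B].

Section Independence.
Context {disp : measure_display} {T : measurableType disp} {R : realType}.
Variable P : probability T R.

Definition mutually_independent {I : choiceType} (F : I -> set (set T)) : Prop :=
  forall (J : {fset I}) (E : I -> set T), (forall i, i \in J -> F i (E i)) ->
    P (\bigcap_(i in [set` J]) E i) = (\prod_(i <- J) P (E i))%E.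

(* The sigma-algebra generated by a family of variables, for the discrete
   sigma-algebra on [V]; to be used with a countable [V] only. *)
Definition sigma_of {I V : Type} (Y : I -> T -> V) : set (set T) :=
  <<s [set E | exists (i : I) (B : set V), E = Y i @^-1` B] >>.

End Independence.

Section RandomWalk.
Context {disp : measure_display} {T : measurableType disp} {R : realType}.
Variable P : probability T R.
Context {d : nat}.

Definition neighbour (e : Zd d) : Prop :=
  exists i : 'I_d, e = delta_mx ord0 i \/ e = - delta_mx ord0 i.

Definition increment (X : nat -> T -> Zd d) (n : nat) : T -> Zd d :=
  fun w => X n.+1 w - X n w.

(* There are [2 * d] neighbours, so the prescribed probabilities sum to [1]
   and determine the law of each increment. *)
Definition simple_random_walk (X : nat -> T -> Zd d) : Prop :=
  [/\ forall n (B : set (Zd d)), measurable (X n @^-1` B),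
      forall w, X 0%N w = 0,
      forall n e, neighbour e ->
        P (increment X n @^-1` [set e]) = (((2 * d)%:R : R)^-1)%:E &
      mutually_independent P
        (fun n => sigma_of (fun _ : unit => increment X n))].

Definition independent_walks {N : nat} (X : 'I_N -> nat -> T -> Zd d) : Prop :=
  mutually_independent P (fun i => sigma_of (X i)).

Definition walk_range (X : nat -> T -> Zd d) (w : T) : set (Zd d) :=
  range (fun n => X n w).

Definition sum_of_ranges {N : nat} (X : 'I_N -> nat -> T -> Zd d) (w : T) :
    set (Zd d) :=
  \big[minkowski_sum/[set 0]]_(i < N) walk_range (X i) w.

End RandomWalk.

(* Main.v *)
(* For a probability nu on A, let Z be the nu-weighted number of visits to A of
   the additive walk z + X^1_{n_1} + ... + X^N_{n_N}. Its Green function is of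
   order |x|^(2N-d), so E[Z] is of order |z|^(2N-d), while
   E[Z^2] <= C |z|^(2N-d) E(nu), where E(nu) is the energy of nu.

   The lower bound is the second moment method. For the upper bound, let tau be
   an arbitrary (multi-)index of a visit to A and nu the law of the visited point
   given a visit. The conditional expectation of Z given the increments before n
   is at least the Green potential of nu at the current point, so that
   P(hit) E(nu) <= C E[Z sum_n E_n 1_{tau=n}]. Each E_n is a product of N one-parameter
   conditional expectations, and the dual form of Doob's inequality, iterated N
   times, gives |sum_n E_n 1_{tau=n}|_2 <= 2^N P(hit)^(1/2). With Cauchy-Schwarz
   P(hit) <= C |z|^(2N-d) / E(nu) follows; no stopping time is needed.

   Heat kernel bounds are obtained without Fourier analysis. The return
   probability a_m = p_{2m}(0) is convex in m, and a_m - a_{m+1} controls the l^2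
   distance between p_m + p_{m+1} and its translates; averaging over a box gives
   a_m <= C m^(-d/2), and the same estimate gives a lower bound near the diagonal.
   For finitely many times everything is a count over the increments. *)
Require Import Defs.
From HB Require Import structures.
From mathcomp Require Import all_boot all_order all_algebra.
From mathcomp Require Import finmap.
From mathcomp Require Import all_classical all_reals all_analysis.
From mathcomp Require Import zify ring lra.

Set Implicit Arguments.
Unset Strict Implicit.
Unset Printing Implicit Defensive.

Import Order.TTheory GRing.Theory Num.Theory.

Local Open Scope classical_set_scope.
Local Open Scope ring_scope.

(** * Simple random walk on Z^d *)

(** With several clocks the visits to [A] are only partially ordered, so there is no first or last
    visit at which to decompose; this obstacle is why the conditioning is done one clock at a time.
    All bounds are proved for clocks cut off at [K], with constants independent of [K], and pass to
    the limit by monotone continuity. The cutoff must exceed a threshold depending on [A] and [z],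
    since the truncated Green function at [x] reaches its full order only after about [|x|^2] steps.
    The law [nu] of the upper bound changes with [K], but its energy is only compared with the
    infimum. In the second moment a pair of time vectors is split at its coordinatewise minimum: the
    common increments lead to a point [u], from which two independent walks run on complementary
    sets of clocks. Their Green functions recombine because the numbers of clocks add up to [N]. Off
    the diagonal the bound [|x|^(-d)] is enough: summed over the time vectors of total at most
    [|x|^2] it gives [|x|^(2N-d)], and the remaining times are summable because [2N < d]. *)

Section Lattice.
Variable d : nat.
Implicit Types x y : Zd d.

(** The graph distance to the origin: it carries the parity of the walk and allows induction along
    nearest-neighbour paths, and is compared with [enorm] only at the end. *)
Definition nrm x : nat := \sum_(i < d) `|x ord0 i|%N.

(** Index and sign of a step, so that steps form a finite type with an obvious involution;
    [neighbour] is only a predicate. *)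
Definition dir : Type := 'I_d * bool.
HB.instance Definition _ := Finite.copy dir ('I_d * bool)%type.

Definition vec (e : dir) : Zd d :=
  if e.2 then - delta_mx ord0 e.1 else delta_mx ord0 e.1.

Definition opp_dir (e : dir) : dir := (e.1, ~~ e.2).

Lemma opp_dirK : involutive opp_dir.
Proof. by move=> [i b]; rewrite /opp_dir /= negbK. Qed.

Lemma vec_opp e : vec (opp_dir e) = - vec e.
Proof. by case: e => i []; rewrite /vec /= ?opprK. Qed.

Lemma nrm0 : nrm 0 = 0%N.
Proof. by rewrite /nrm big1 // => i _; rewrite mxE. Qed.

Lemma nrm_eq0 x : (nrm x == 0%N) = (x == 0).
Proof.
apply/idP/eqP => [|->]; last by rewrite nrm0.
rewrite /nrm sum_nat_eq0 => /forallP h; apply/rowP => i; rewrite mxE.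
by have /= := h i; rewrite absz_eq0 => /eqP.
Qed.

Lemma nrmN x : nrm (- x) = nrm x.
Proof. by rewrite /nrm; apply: eq_bigr => i _; rewrite mxE abszN. Qed.

Lemma nrmD x y : (nrm (x + y) <= nrm x + nrm y)%N.
Proof. by rewrite /nrm -big_split leq_sum // => i _ /=; rewrite mxE; move: (x _ _) (y _ _); lia. Qed.

Lemma nrmB x y : (nrm (x - y) <= nrm x + nrm y)%N.
Proof. by rewrite -(nrmN y) nrmD. Qed.

Lemma leq_coord_nrm x i : (`|x ord0 i| <= nrm x)%N.
Proof. by rewrite /nrm (bigD1 i) //= leq_addr. Qed.

Lemma vecE e (i : 'I_d) : vec e ord0 i = (-1) ^+ e.2 * (i == e.1)%:R.
Proof.
by case: e => j []; rewrite /vec /= !mxE eqxx /= ?mul1r ?mulN1r // expr1 mulN1r.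
Qed.

Lemma vec_inj : injective vec.
Proof.
move=> [i b] [j c] /rowP ef; have := ef i; rewrite !vecE /= eqxx.
by case: eqVneq => [->|_]; case: b {ef}; case: c.
Qed.

Lemma nrm_vec e : nrm (vec e) = 1%N.
Proof.
rewrite /nrm (bigD1 e.1) //= big1 => [|i ie].
  by rewrite vecE eqxx mulr1; case: e.2.
by rewrite vecE (negPf ie) mulr0.
Qed.

Lemma odd_nrm_vec x e : odd (nrm (x + vec e)) = ~~ odd (nrm x).
Proof.
rewrite /nrm (bigD1 e.1) //= [in RHS](bigD1 e.1) //= !oddD -addNb.
congr (_ (+) _).
  by rewrite mxE vecE eqxx mulr1; case: e.2; rewrite /=; lia.
congr (odd _); apply: eq_bigr => i ie.
by rewrite mxE vecE (negPf ie) mulr0 addr0.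
Qed.

Lemma nrm_descent x : x != 0 -> exists e, nrm (x - vec e) = (nrm x).-1.
Proof.
move=> x0; have /existsP[i xi] : [exists i, x ord0 i != 0].
  apply: contraNT x0 => /existsPn h; apply/eqP/rowP => i; rewrite mxE.
  by apply/eqP/negPn/h.
exists (i, x ord0 i < 0); rewrite /nrm (bigD1 i) //= [in RHS](bigD1 i) //=.
rewrite (eq_bigr (fun j => `|x ord0 j|%N)) => [|j ji]; last first.
  by rewrite 2!mxE vecE (negPf ji) mulr0 subr0.
rewrite 2!mxE vecE eqxx mulr1 /=; move: xi (\sum_(j < d | _) _)%N.
case: ltP; move: (x _ _) => c h /eqP c0 s; rewrite /= ?expr1 ?expr0; lia.
Qed.

Definition box_pt (K : nat) (f : {ffun 'I_d -> 'I_(2 * K).+1}) : Zd d :=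
  \row_i ((f i : nat)%:Z - K%:Z).

Definition box (K : nat) : seq (Zd d) := codom (@box_pt K).

Lemma box_uniq K : uniq (box K).
Proof.
apply/injectiveP => f g /rowP fg; apply/ffunP => i; apply: val_inj.
by have := fg i; rewrite !mxE /=; lia.
Qed.

Lemma size_box K : size (box K) = ((2 * K).+1 ^ d)%N.
Proof. by rewrite size_codom card_ffun !card_ord. Qed.

Lemma mem_boxP K x : reflect (forall i, `|x ord0 i| <= K)%N (x \in box K).
Proof.
apply: (iffP codomP) => [[f ->] i|h].
  by rewrite mxE; case: (f i) => m /=; lia.
exists [ffun i => inord `|(x ord0 i + K%:Z)%R|%N]; apply/rowP => i.
by rewrite mxE ffunE; move: (h i); move: (x _ _) => c cK; rewrite inordK; lia.
Qed.

Lemma mem_box K x : (nrm x <= K)%N -> x \in box K.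
Proof. by move=> xK; apply/mem_boxP => i; apply: leq_trans (leq_coord_nrm _ _) xK. Qed.

Lemma nrm_box K x : x \in box K -> (nrm x <= d * K)%N.
Proof.
move=> /mem_boxP h; rewrite -[d in leqRHS]card_ord -sum_nat_const.
exact: leq_sum.
Qed.

End Lattice.

Arguments vec {d}.
Arguments nrm {d}.

(** * Transition operator and heat kernel *)

Section Step.
Context {R : realType} {d : nat}.
Implicit Types (f g F : Zd d -> R) (x y a : Zd d).

Definition step f x : R := (2 * d)%:R^-1 * \sum_(e : dir d) f (x + vec e).

Definition steps n f := iter n step f.

Definition dirac0 x : R := (x == 0)%:R.

Definition heat n : Zd d -> R := steps n dirac0.

Lemma stepsS n f : steps n.+1 f = step (steps n f).
Proof. by []. Qed.

Lemma stepsSr n f : steps n.+1 f = steps n (step f).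
Proof. exact: iterSr. Qed.

Lemma stepsD m n f : steps (m + n) f = steps m (steps n f).
Proof. exact: iterD. Qed.

Lemma steps_shift n f a x : steps n (fun y => f (y + a)) x = steps n f (x + a).
Proof.
elim: n x => // n IH x; rewrite !stepsS /step; congr (_ * _).
by apply: eq_bigr => e _; rewrite IH addrAC.
Qed.

Lemma step_reflect f x : step (fun y => f (- y)) x = step f (- x).
Proof.
rewrite /step; congr (_ * _); rewrite (reindex_inj (inv_inj (@opp_dirK d))).
by apply: eq_bigr => e _; rewrite vec_opp opprD opprK.
Qed.

Lemma steps_reflect n f x : steps n (fun y => f (- y)) x = steps n f (- x).
Proof.
elim: n x => // n IH x; rewrite !stepsS -step_reflect /step; congr (_ * _).
by apply: eq_bigr => e _; rewrite IH.
Qed.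

Lemma steps_add n f g x :
  steps n (fun y => f y + g y) x = steps n f x + steps n g x.
Proof.
elim: n x => // n IH x; rewrite !stepsS /step -mulrDr -big_split.
by congr (_ * _); apply: eq_bigr => e _; rewrite IH.
Qed.

Lemma steps_scale n c f x : steps n (fun y => c * f y) x = c * steps n f x.
Proof.
elim: n x => // n IH x; rewrite !stepsS /step [RHS]mulrCA; congr (_ * _).
by rewrite mulr_sumr; apply: eq_bigr => e _; rewrite IH.
Qed.

Lemma steps_sum (I : Type) (r : seq I) (Q : pred I) n (f : I -> Zd d -> R) x :
  steps n (fun y => \sum_(i <- r | Q i) f i y) x =
  \sum_(i <- r | Q i) steps n (f i) x.
Proof.
elim: n x => // n IH x; rewrite !stepsS /step (eq_bigr _ (fun e _ => IH _)).
by rewrite exchange_big mulr_sumr.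
Qed.

Lemma eq_step f g x : (forall y, f y = g y) -> step f x = step g x.
Proof. by move=> fg; congr (_ * _); apply: eq_bigr => e _. Qed.

Lemma eq_steps n f g x : (forall y, f y = g y) -> steps n f x = steps n g x.
Proof. by move=> fg; elim: n x => // n IH x; apply: eq_step. Qed.

Lemma steps_le n f g x :
  (forall y, f y <= g y) -> steps n f x <= steps n g x.
Proof.
move=> fg; elim: n x => // n IH x; rewrite !stepsS /step.
by rewrite ler_wpM2l ?invr_ge0 // ler_sum.
Qed.

Lemma steps0 n x : steps n (fun=> 0) x = 0.
Proof.
by elim: n x => // n IH x; rewrite stepsS /step big1 ?mulr0.
Qed.

Lemma steps_ge0 n f x : (forall y, 0 <= f y) -> 0 <= steps n f x.
Proof. by move=> f0; rewrite -(steps0 n x); apply: steps_le. Qed.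

Lemma heat_ge0 n x : 0 <= heat n x.
Proof. exact: steps_ge0. Qed.

Lemma heatN n x : heat n (- x) = heat n x.
Proof. by rewrite /heat -steps_reflect; apply: eq_steps => y; rewrite /dirac0 oppr_eq0. Qed.

Lemma heatBC n x y : heat n (x - y) = heat n (y - x).
Proof. by rewrite -heatN opprB. Qed.

Lemma steps_heat m n a x :
  steps m (fun y => heat n (y - a)) x = heat (m + n) (x - a).
Proof. by rewrite (steps_shift m (heat n) (- a)) /heat stepsD. Qed.

Lemma heat_parity n x : odd (nrm x) != odd n -> heat n x = 0.
Proof.
elim: n x => [|n IH] x nx.
  rewrite /heat /= /dirac0 -nrm_eq0; case: (nrm x) nx => //.
rewrite /heat stepsS /step big1 ?mulr0 // => e _; apply: IH.
by rewrite odd_nrm_vec; move: nx => /=; case: odd; case: odd.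
Qed.

(* Sums over Z^d of finitely supported functions are taken over large boxes. *)
Lemma sum_dirac0 K a F : a \in box d K ->
  \sum_(u <- box d K) dirac0 (u - a) * F u = F a.
Proof.
move=> aK; rewrite (bigD1_seq a) ?box_uniq //= big1 => [|u ua].
  by rewrite /dirac0 subrr eqxx mul1r addr0.
by rewrite /dirac0 subr_eq0 (negPf ua) mul0r.
Qed.

(** The condition on [K] puts the whole support of the kernel started at [a] inside the box, which
    makes the finite sum an exact expectation. *)
Lemma sum_heat n K a F : (nrm a + n <= K)%N ->
  \sum_(u <- box d K) heat n (u - a) * F u = steps n F a.
Proof.
elim: n a => [|n IH] a aK; first by apply/sum_dirac0/mem_box; lia.
under eq_bigr => u _ do rewrite /heat stepsS -[_ * F u]mulrA mulr_suml.
rewrite -mulr_sumr exchange_big stepsS /step; congr (_ * _).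
rewrite [RHS](reindex_inj (inv_inj (@opp_dirK d))); apply: eq_bigr => e _.
rewrite vec_opp -IH; last by have := nrmB a (vec e); rewrite nrm_vec; lia.
by apply: eq_bigr => u _; rewrite opprB addrA addrAC.
Qed.

Lemma sum_heat_le n K a F : (forall y, 0 <= F y) ->
  \sum_(u <- box d K) heat n (u - a) * F u <= steps n F a.
Proof.
(* The larger box contains the support of the kernel and also [box d K], whose points have norm at
   most [d * K]. *)
move=> F0; rewrite -(sum_heat (K := nrm a + n + d * K)) //; last lia.
rewrite [leRHS](bigID (fun u => u \in box d K)) /= -[leLHS]addr0 lerD //.
  rewrite -[leRHS]big_filter le_eqVlt; apply/orP; left; apply/eqP/perm_big.
  apply: uniq_perm; rewrite ?filter_uniq ?box_uniq // => u.
  rewrite mem_filter; case: (boolP (u \in box d K)) => // /nrm_box uK.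
  by rewrite mem_box //; lia.
by apply: sumr_ge0 => u _; rewrite mulr_ge0 ?heat_ge0.
Qed.

Hypothesis d_gt0 : (0 < d)%N.

Lemma steps_cst n c x : steps n (fun=> c) x = c.
Proof.
elim: n x => // n IH x; rewrite stepsS /step (eq_bigr _ (fun e _ => IH _)).
rewrite sumr_const card_prod card_ord card_bool mulnC -[c *+ _]mulr_natl mulKf //.
by rewrite pnatr_eq0; lia.
Qed.

Lemma heat_le1 n x : heat n x <= 1.
Proof.
rewrite -(steps_cst n 1 x); apply: steps_le => y.
by rewrite /dirac0; case: (y == 0).
Qed.

End Step.

Arguments steps : simpl never.
Arguments heat : simpl never.

(** * Heat kernel bounds *)

Section Diagonal.
Context {R : realType} {d : nat}.
Hypothesis d_gt0 : (0 < d)%N.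
Implicit Types (x y a b : Zd d).
Local Notation heat := (@heat R d).

Definition ret m : R := heat (2 * m) 0.

Definition drop_ret m : R := ret m - ret m.+1.

(* Adding two consecutive times removes the parity constraint; the inner
   products of translates of [heat m + heat m.+1] are the values of [heat3]. *)
Definition heat3 m x : R :=
  heat (2 * m) x + 2 * heat (2 * m).+1 x + heat (2 * m).+2 x.

Let heat2 m x : R := heat m x + heat m.+1 x.

Lemma heat_odd0 m : heat (2 * m).+1 0 = 0.
Proof. by rewrite heat_parity // nrm0 /= mul2n odd_double. Qed.

Lemma heat3_0 m : heat3 m 0 = ret m + ret m.+1.
Proof. by rewrite /heat3 heat_odd0 mulr0 addr0 /ret mulnS. Qed.

Lemma ret_ge0 m : 0 <= ret m. Proof. exact: heat_ge0. Qed.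

Lemma sum_heat2 m a b K : (nrm a + m.+1 <= K)%N ->
  \sum_(u <- box d K) heat2 m (u - a) * heat2 m (u - b) = heat3 m (a - b).
Proof.
move=> aK; under eq_bigr do rewrite mulrDl; rewrite big_split /= !sum_heat; try lia.
rewrite !steps_add !steps_heat !addnS !addSn addnn -mul2n /heat3.
by rewrite -!addrA; congr (_ + _); rewrite mulr_natl addrA.
Qed.

Lemma sum_heat2_sqr m a b K : (nrm a + nrm b + m.+1 <= K)%N ->
  \sum_(u <- box d K) (heat2 m (u - a) - heat2 m (u - b)) ^+ 2 =
  2 * (heat3 m 0 - heat3 m (a - b)).
Proof.
move=> abK; transitivity (\sum_(u <- box d K) (heat2 m (u - a) * heat2 m (u - a)
   - 2 * (heat2 m (u - a) * heat2 m (u - b)) + heat2 m (u - b) * heat2 m (u - b))).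
  by apply: eq_bigr => u _; ring.
rewrite !big_split /= sumrN -mulr_sumr !sum_heat2; try lia.
by rewrite !subrr; ring.
Qed.

Lemma heat3_le0 m x : heat3 m x <= heat3 m 0.
Proof.
have := @sum_heat2_sqr m x 0 _ (leqnn _); rewrite subr0 => h.
by rewrite -subr_ge0 -(pmulr_rge0 _ (ltr0n R 2)) -h sumr_ge0 // => u _; rewrite sqr_ge0.
Qed.

Lemma step_heat3 m : step (heat3 m) 0 = 2 * ret m.+1.
Proof.
have -> : step (heat3 m) 0 = heat (2 * m).+1 0 + 2 * heat (2 * m).+2 0 + heat (2 * m).+3 0.
  rewrite -[LHS]/(steps 1 _ 0) /heat3 2!steps_add steps_scale.
  by congr (_ + _ * _ + _).
have -> : ((2 * m).+2 = 2 * m.+1)%N by lia.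
by rewrite !heat_odd0 add0r addr0.
Qed.

Lemma card_dir : #|{: dir d}| = (2 * d)%N.
Proof. by rewrite card_prod card_ord card_bool mulnC. Qed.

Lemma sum_step (f : Zd d -> R) x :
  \sum_(e : dir d) f (x + vec e) = (2 * d)%:R * step f x.
Proof. by rewrite /step mulrA mulfV ?mul1r // pnatr_eq0; lia. Qed.

(** The nonnegative differences over all directions sum to exactly the right side, because the
    average of [heat3 m] over the neighbours of the origin is [2 * ret m.+1]. *)
Lemma heat3_vec m e : heat3 m 0 - heat3 m (vec e) <= (2 * d)%:R * drop_ret m.
Proof.
have -> : (2 * d)%:R * drop_ret m = \sum_(e : dir d) (heat3 m 0 - heat3 m (vec e)).
  rewrite sumrB sumr_const card_dir -(eq_bigr _ (fun e _ => congr1 _ (add0r (vec e)))).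
  by rewrite sum_step step_heat3 heat3_0 /drop_ret -[_ *+ (2 * d)]mulr_natl; ring.
by rewrite (bigD1 e) //= lerDl sumr_ge0 // => i _; rewrite subr_ge0 heat3_le0.
Qed.

Lemma drop_ret_ge0 m : 0 <= drop_ret m.
Proof.
have e : dir d by exact: (Ordinal d_gt0, true).
rewrite -(@pmulr_rge0 _ (2 * d)%:R) ?ltr0n; last lia.
by apply: le_trans (heat3_vec m e); rewrite subr_ge0 heat3_le0.
Qed.

Lemma ret_mono m n : (m <= n)%N -> ret n <= ret m.
Proof.
elim: n => [|n IH]; first by rewrite leqn0 => /eqP ->.
rewrite leq_eqVlt ltnS => /orP[/eqP -> //|/IH]; apply: le_trans.
by rewrite -subr_ge0 -/(drop_ret n) drop_ret_ge0.
Qed.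

(* [2 * (heat3 m 0 - heat3 m x)] is the squared l^2 distance between a function
   and its translate by [x]; apply the triangle inequality along a path of
   [nrm x] unit steps. *)
Lemma heat3_drop m x :
  heat3 m 0 - heat3 m x <= (nrm x)%:R ^+ 2 * (2 * d)%:R * drop_ret m.
Proof.
elim: (nrm x) {-2}x (erefl (nrm x)) => [|n IH] {}x nx.
  by move/eqP: nx; rewrite nrm_eq0 => /eqP ->; rewrite subrr !mulr_ge0 ?exprn_ge0 ?drop_ret_ge0.
have [|e xe] := @nrm_descent d x; first by rewrite -nrm_eq0 nx.
move: xe; rewrite nx /=; set y := x - vec e => ny.
have [K xK] : exists K, (nrm x + nrm y + m.+2 <= K)%N by exists (nrm x + nrm y + m.+2)%N.
have h1 := @sum_heat2_sqr m x y K ltac:(lia).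
have h2 := @sum_heat2_sqr m y 0 K ltac:(rewrite nrm0; lia).
have h3 := @sum_heat2_sqr m x 0 K ltac:(rewrite nrm0; lia).
rewrite subr0 in h2; rewrite subr0 in h3.
rewrite (_ : x - y = vec e) in h1; last by rewrite /y opprB addrC subrK.
have := IH _ ny; rewrite ny; have := heat3_vec m e.
set D := drop_ret m; set q := (2 * d)%:R => A1 A2.
have D0 : 0 <= D := drop_ret_ge0 m.
have [n0|n0] := posnP n.
  have y0 : y = 0 by apply/eqP; rewrite -nrm_eq0 ny n0.
  by rewrite n0 expr1n mul1r; have -> : x = vec e by apply/eqP; rewrite -subr_eq0 -/y y0.
have n0' : 0 < n%:R :> R by rewrite ltr0n.
(* Triangle inequality in squared form; the weights are chosen so that
   [(1 + n) + (1 + n^-1) * n^2 = (n + 1)^2]. *)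
have key : \sum_(u <- box d K) (heat2 m (u - x) - heat2 m (u - 0)) ^+ 2 <=
    (1 + n%:R) * \sum_(u <- box d K) (heat2 m (u - x) - heat2 m (u - y)) ^+ 2 +
    (1 + n%:R^-1) * \sum_(u <- box d K) (heat2 m (u - y) - heat2 m (u - 0)) ^+ 2.
  rewrite !mulr_sumr -big_split ler_sum //= => u _.
  set s := heat2 _ _; set t := heat2 _ (u - y); set w := heat2 _ _.
  rewrite -subr_ge0; have -> : (1 + n%:R) * (s - t) ^+ 2 + (1 + n%:R^-1) * (t - w) ^+ 2 - (s - w) ^+ 2 =
      n%:R^-1 * (n%:R * (s - t) - (t - w)) ^+ 2 by field; rewrite lt0r_neq0.
  by rewrite mulr_ge0 ?sqr_ge0 // invr_ge0 ltW.
rewrite h1 h2 h3 in key.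
have E1 : (1 + n%:R) * (2 * (heat3 m 0 - heat3 m (vec e))) <= (1 + n%:R) * (2 * (q * D)).
  by rewrite ler_wpM2l ?addr_ge0 ?ler0n // ler_wpM2l.
have E2 : (1 + n%:R^-1) * (2 * (heat3 m 0 - heat3 m y)) <= (1 + n%:R^-1) * (2 * (n%:R ^+ 2 * q * D)).
  by rewrite ler_wpM2l ?addr_ge0 ?invr_ge0 ?ler0n // ler_wpM2l.
have -> : n.+1%:R ^+ 2 * q * D = ((1 + n%:R) * (2 * (q * D)) + (1 + n%:R^-1) * (2 * (n%:R ^+ 2 * q * D))) / 2.
  by rewrite -natr1; field; rewrite lt0r_neq0.
lra.
Qed.

(* [ret] is convex: its second difference at [k] is [|p_k - p_{k+2}|^2] in l^2. *)
Lemma drop_ret_mono m n : (m <= n)%N -> drop_ret n <= drop_ret m.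
Proof.
suff h k : drop_ret k.+1 <= drop_ret k.
  elim: n => [|n IH]; first by rewrite leqn0 => /eqP ->.
  by rewrite leq_eqVlt ltnS => /orP[/eqP -> //|/IH]; apply: le_trans.
have : 0 <= \sum_(u <- box d k.+2) (heat k (u - 0) - heat k.+2 (u - 0)) ^+ 2.
  by apply: sumr_ge0 => u _; rewrite sqr_ge0.
have -> : \sum_(u <- box d k.+2) (heat k (u - 0) - heat k.+2 (u - 0)) ^+ 2 =
  \sum_(u <- box d k.+2) (heat k (u - 0) * heat k (u - 0) - 2 * (heat k (u - 0) * heat k.+2 (u - 0))
     + heat k.+2 (u - 0) * heat k.+2 (u - 0)).
  by apply: eq_bigr => u _; ring.
rewrite !big_split /= sumrN -mulr_sumr !sum_heat ?nrm0; try lia.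
rewrite !steps_heat subrr /drop_ret /ret.
rewrite !addSn !addnS addnn -!mul2n (_ : 2 * k.+1 = (2 * k).+2)%N; last lia.
by rewrite (_ : 2 * k.+2 = (2 * k).+4)%N; [lra|lia].
Qed.

(** The drops between times [m] and [2 * m] telescope, and by convexity each of them is at least
    [drop_ret (2 * m)]. *)
Lemma mul_drop_ret m : m%:R * drop_ret (2 * m) <= ret m.
Proof.
suff h k : k%:R * drop_ret (m + k) <= ret m - ret (m + k).
  by have := h m; rewrite addnn -mul2n; have := ret_ge0 (2 * m); lra.
elim: k => [|k IH]; first by rewrite addn0 mul0r subrr.
rewrite -natr1 mulrDl mul1r.
have := drop_ret_mono (leqnSn (m + k)); rewrite addnS => D.
have : k%:R * drop_ret (m + k).+1 <= k%:R * drop_ret (m + k) by rewrite ler_wpM2l.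
have : drop_ret (m + k) = ret (m + k) - ret (m + k).+1 by [].
lra.
Qed.

Lemma heat_sum_box r n : \sum_(x <- box d r) heat n x <= 1.
Proof.
rewrite -(steps_cst d_gt0 n 1 0); apply: le_trans (sum_heat_le n r 0 _) => //.
by apply: ler_sum => u _; rewrite subr0 mulr1.
Qed.

(** Average of [heat3_drop] over a box: [heat3 m] has mass at most [1 + 2 + 1], and [nrm x <= d * r]
    turns the loss into [(d * r)^2 * 2d] drops. *)
Lemma heat3_0_upper m r :
  heat3 m 0 <= 4 / (2 * r).+1%:R ^+ d + (2 * d ^ 3 * r ^ 2)%:R * drop_ret m.
Proof.
set V : R := (2 * r).+1%:R ^+ d.
have V0 : 0 < V by rewrite exprn_gt0 ?ltr0n.
have h : \sum_(x <- box d r) heat3 m 0 <=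
    \sum_(x <- box d r) (heat3 m x + (2 * d ^ 3 * r ^ 2)%:R * drop_ret m).
  rewrite !big_seq ler_sum // => x /nrm_box xr.
  rewrite -lerBlDl; apply: le_trans (heat3_drop m x) _.
  rewrite ler_wpM2r ?drop_ret_ge0 // -natrX -natrM ler_nat.
  have : (nrm x ^ 2 <= (d * r) ^ 2)%N by rewrite leq_exp2r.
  rewrite expnMn !expnS !expn0 !muln1; nia.
have sz (c : R) : \sum_(x <- box d r) c = V * c.
  by rewrite big_const_seq count_predT size_box iter_addr addr0 -[c *+ _]mulr_natl natrX.
move: h; rewrite [leRHS]big_split /= !sz.
have : \sum_(x <- box d r) heat3 m x <= 4.
  rewrite /heat3 !big_split /= -mulr_sumr.
  have := heat_sum_box r (2 * m); have := heat_sum_box r (2 * m).+1.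
  have := heat_sum_box r (2 * m).+2; lra.
have VV : V * (4 / V) = 4 by rewrite mulrCA mulfV ?mulr1 ?gt_eqF.
by move=> A B; rewrite -(ler_pM2l V0) [leRHS]mulrDr VV; lra.
Qed.

(** Half of [Ldiag * r ^ 2] is [2 * 3^d] times the coefficient [2 * d^3 * r^2] of [heat3_0_upper];
    this beats the factor [3^d] lost in [ret_upper] by passing from [r] to [r %/ 2]. *)
Definition Ldiag := (8 * d ^ 3 * 3 ^ d)%N.

Lemma Ldiag_gt0 : (0 < Ldiag)%N.
Proof. by rewrite /Ldiag !muln_gt0 !expn_gt0 d_gt0. Qed.

(* [heat3_0_upper] at time [2h] with [h] of order [r^2] bounds [ret (2h)] by
   [4 / r^d] plus a small multiple of [ret h]; iterate over [r %/ 2]. *)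
Lemma ret_upper r j : (0 < r)%N -> (Ldiag * r ^ 2 <= j)%N ->
  ret j <= 8 / r%:R ^+ d.
Proof.
move=> r0 rj; apply: le_trans (ret_mono rj) _ => {j rj}.
elim/ltn_ind: r r0 => r IH r0.
have [r1|r1] := leqP r 1.
  have -> : r = 1%N by lia.
  rewrite expr1n divr1; apply: le_trans (heat_le1 _ _ _) _ => //.
  by rewrite ler1n.
set h := (4 * d ^ 3 * 3 ^ d * r ^ 2)%N.
have -> : (Ldiag * r ^ 2 = 2 * h)%N by rewrite /Ldiag /h; lia.
have h0 : (0 < h)%N by rewrite /h !muln_gt0 !expn_gt0 d_gt0 r0.
have := IH (r %/ 2)%N ltac:(lia) ltac:(lia); set s := (r %/ 2)%N => IHs.
have s0 : (0 < s)%N by rewrite /s; lia.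
have hs : ret h <= 8 / s%:R ^+ d.
  apply: le_trans IHs; apply: ret_mono.
  have : (4 * s ^ 2 <= r ^ 2)%N.
    rewrite -[4%N]/(2 ^ 2)%N -expnMn leq_exp2r //; rewrite /s; lia.
  rewrite /h /Ldiag; move: (d ^ 3)%N (3 ^ d)%N (s ^ 2)%N (r ^ 2)%N => A B C D.
  by move=> /(leq_mul (leqnn (A * B)%N)); nia.
have rd0 : 0 < r%:R ^+ d :> R by rewrite exprn_gt0 ?ltr0n.
have sd0 : 0 < s%:R ^+ d :> R by rewrite exprn_gt0 ?ltr0n.
have t0 : 0 < 3 ^+ d :> R by rewrite exprn_gt0 ?ltr0n.
(* For [r >= 2] the rounded half satisfies [r <= 3 * (r %/ 2)]. *)
have hs' : ret h <= 8 * 3 ^+ d / r%:R ^+ d.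
  apply: le_trans hs _; rewrite ler_pdivlMr // mulrAC ler_pdivrMr // -mulrA.
  rewrite ler_wpM2l // -!natrX -natrM ler_nat -expnMn leq_exp2r //; rewrite /s; lia.
have := @heat3_0_upper (2 * h) r; rewrite heat3_0 => A.
have B := mul_drop_ret h.
have C : (2 * d ^ 3 * r ^ 2)%:R * drop_ret (2 * h) <= 4 / r%:R ^+ d.
  have hE : h%:R = 2 * 3 ^+ d * (2 * d ^ 3 * r ^ 2)%:R :> R.
    by rewrite /h -natrX -!natrM; congr (_%:R); lia.
  have : 2 * 3 ^+ d * ((2 * d ^ 3 * r ^ 2)%:R * drop_ret (2 * h)) <= 2 * 3 ^+ d * (4 / r%:R ^+ d).
    rewrite mulrA -hE; apply: le_trans B _; apply: le_trans hs' _.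
    by rewrite le_eqVlt; apply/orP; left; apply/eqP; field; rewrite gt_eqF.
  by rewrite ler_pM2l // mulr_gt0.
have E : 4 / (2 * r).+1%:R ^+ d <= 4 / r%:R ^+ d :> R.
  rewrite ler_wpM2l // lef_pV2 ?posrE ?exprn_gt0 ?ltr0n //.
  by rewrite lerXn2r ?nnegrE // ler_nat; lia.
have := ret_ge0 (2 * h).+1.
rewrite (_ : 8 / r%:R ^+ d = 4 / r%:R ^+ d + 4 / r%:R ^+ d); last by field; rewrite gt_eqF.
lra.
Qed.

End Diagonal.

Arguments Ldiag : clear implicits.

(** * Uniform and off-diagonal upper bounds *)

Section UpperBounds.
Context {R : realType} {d : nat}.
Hypothesis d_gt0 : (0 < d)%N.
Implicit Types (x y a b u : Zd d).
Local Notation heat := (@heat R d).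
Local Notation ret := (@ret R d).

Definition rt (n : nat) : R := Num.sqrt n%:R.

Lemma rt_ge0 n : 0 <= rt n. Proof. exact: sqrtr_ge0. Qed.

Lemma rt_gt0 n : 0 < rt n.+1. Proof. by rewrite sqrtr_gt0 ltr0n. Qed.

Lemma sqr_rt n : rt n ^+ 2 = n%:R. Proof. by rewrite sqr_sqrtr. Qed.

Lemma rt_sqr n : rt (n ^ 2) = n%:R.
Proof. by rewrite /rt natrX sqrtr_sqr normr_nat. Qed.

Lemma ler_rt m n : (m <= n)%N -> rt m <= rt n.
Proof. by move=> mn; rewrite ler_wsqrtr // ler_nat. Qed.

Lemma rt_ge1 n : 1 <= rt n.+1.
Proof. by rewrite -[leLHS](rt_sqr 1) ler_rt. Qed.

Lemma nat_sqrt_floor n : exists2 r, (0 < r)%N & (r ^ 2 <= n.+1 < r.+1 ^ 2)%N.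
Proof.
elim: n => [|n [r r0 /andP[h1 h2]]]; first by exists 1%N.
have [h|h] := ltnP n.+2 (r.+1 ^ 2); first by exists r; rewrite ?h ?andbT //; lia.
by exists r.+1 => //; rewrite h /=; lia.
Qed.

(** Both parities occur in [heat3], so its maximum at the origin also controls the odd times, at
    which the kernel itself vanishes there. *)
Lemma heat_ret n x : heat n x <= 2 * ret (n %/ 2)%N.
Proof.
set j := (n %/ 2)%N.
have h := @heat3_le0 R d d_gt0 j x; rewrite heat3_0 in h.
have := @ret_mono R d d_gt0 _ _ (leqnSn j).
have [] := (@heat_ge0 R d (2 * j) x, @heat_ge0 R d (2 * j).+1 x).
have := @heat_ge0 R d (2 * j).+2 x; move: h; rewrite /heat3.
have [->|->] : (n = 2 * j \/ n = (2 * j).+1)%N by rewrite /j; lia.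
  lra.
lra.
Qed.

Definition Cunif : R := 16 * (4 * Ldiag d)%:R ^+ d.

Lemma heat_unif_nat n x r : (0 < r)%N -> (r ^ 2 <= n.+1)%N ->
  heat n x <= Cunif / r%:R ^+ d.
Proof.
move=> r0 rn; have L0 := Ldiag_gt0 d_gt0; rewrite /Cunif.
have L8 : (8 <= Ldiag d)%N.
  by rewrite /Ldiag -mulnA leq_pmulr // muln_gt0 !expn_gt0 d_gt0.
have rd0 : 0 < r%:R ^+ d :> R by rewrite exprn_gt0 ?ltr0n.
have [h|h] := ltnP r (2 * Ldiag d).
  apply: le_trans (heat_le1 d_gt0 _ _) _; rewrite ler_pdivlMr // mul1r.
  rewrite -!natrX -natrM ler_nat.
  have : (r ^ d <= (4 * Ldiag d) ^ d)%N by rewrite leq_exp2r //; lia.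
  lia.
(* With this radius [Ldiag d * s ^ 2] is at most [n %/ 2], as [ret_upper] requires, while
   [r <= 4 * Ldiag d * s]; this ratio and [2 * 8] make up [Cunif]. *)
set s := (r %/ (2 * Ldiag d))%N.
have s0 : (0 < s)%N by rewrite divn_gt0 // muln_gt0.
have sr : (s * (2 * Ldiag d) <= r)%N by exact: leq_trunc_div.
have rs : (r < s.+1 * (2 * Ldiag d))%N by rewrite ltn_ceil // muln_gt0.
apply: le_trans (heat_ret _ _) _.
apply: le_trans (_ : 2 * (8 / s%:R ^+ d) <= _).
  rewrite ler_wpM2l //; apply: ret_upper => //.
  have : (4 * (Ldiag d * s ^ 2) * Ldiag d <= n.+1)%N.
    apply: leq_trans rn; apply: leq_trans (_ : _ <= (s * (2 * Ldiag d)) ^ 2)%N _.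
      by rewrite !expnS !expn0; nia.
    by rewrite leq_exp2r.
  have : (0 < Ldiag d * s ^ 2)%N by rewrite muln_gt0 L0 expn_gt0 s0.
  move: (Ldiag d * s ^ 2)%N => q; nia.
have sd0 : 0 < s%:R ^+ d :> R by rewrite exprn_gt0 ?ltr0n.
rewrite mulrA -natrM ler_pdivrMr // mulrAC ler_pdivlMr // -!natrX -!natrM ler_nat.
rewrite -[leqRHS]mulnA -expnMn leq_mul // leq_exp2r //; nia.
Qed.

Definition Cdiag : R := Cunif * 2 ^+ d.

Lemma Cdiag_ge1 : 1 <= Cdiag.
Proof.
have h : 1 <= (4 * Ldiag d)%:R :> R by rewrite ler1n muln_gt0 /= Ldiag_gt0.
have := exprn_ege1 d h; have := @exprn_ege1 R d 2 ltac:(lra).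
by rewrite /Cdiag /Cunif; set p := _ ^+ d; set q := _ ^+ d; nra.
Qed.

Lemma heat_unif n x : heat n x <= Cdiag / rt n.+1 ^+ d.
Proof.
have [r r0 /andP[h1 h2]] := nat_sqrt_floor n.
apply: le_trans (heat_unif_nat x r0 h1) _.
have rd0 : 0 < r%:R ^+ d :> R by rewrite exprn_gt0 ?ltr0n.
rewrite /Cdiag -mulrA ler_wpM2l ?mulr_ge0 ?exprn_ge0 //.
rewrite ler_pdivlMr ?exprn_gt0 ?rt_gt0 // mulrC ler_pdivrMr // -exprMn.
rewrite lerXn2r ?nnegrE ?rt_ge0 ?mulr_ge0 //.
rewrite -natrM -rt_sqr ler_rt //; apply: ltnW; apply: leq_trans h2 _.
by rewrite leq_exp2r //; lia.
Qed.

(** Inverts [expR (- y) >= 1 - y], since [1 / (1 - y) <= 1 + y + 2 * y ^+ 2] on this range. *)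
Lemma expR_quad (y : R) : `|y| <= 1 / 2 -> expR y <= 1 + y + 2 * y ^+ 2.
Proof.
rewrite ler_norml => /andP[y1 y2].
have := expR_ge1Dx (- y); rewrite expRN => h.
have p : 0 < 1 - y by lra.
have e0 := expR_gt0 y.
have : expR y * (1 - y) <= 1.
  by rewrite -[leRHS](mulfV (lt0r_neq0 e0)) ler_wpM2l // ltW.
move=> h2; rewrite -(ler_pM2r p); apply: le_trans h2 _.
rewrite -subr_ge0.
have -> : (1 + y + 2 * y ^+ 2) * (1 - y) - 1 = y ^+ 2 * (1 - 2 * y) by ring.
by rewrite mulr_ge0 ?sqr_ge0 //; lra.
Qed.

Lemma sum_vec (i : 'I_d) : \sum_(e : dir d) (vec e ord0 i)%:~R = 0 :> R.
Proof.
set S := \sum_(e : dir d) _; have : S = - S.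
  rewrite {1}/S (reindex_inj (inv_inj (@opp_dirK d))) -sumrN.
  by apply: eq_bigr => e _; rewrite vec_opp mxE intrN.
lra.
Qed.

(** The linear term of [expR_quad] cancels between opposite directions. *)
Lemma step_expR (c : R) (i : 'I_d) x : `|c| <= 1 / 2 ->
  step (fun u => expR (c * (u ord0 i)%:~R)) x <=
  (1 + 2 * c ^+ 2) * expR (c * (x ord0 i)%:~R).
Proof.
move=> c1; rewrite /step.
under eq_bigr => e _ do rewrite mxE intrD mulrDr expRD.
rewrite -mulr_sumr mulrCA mulrC ler_wpM2r ?expR_ge0 //.
have v1 (e : dir d) : `|(vec e ord0 i)%:~R| <= 1 :> R.
  rewrite -intr_norm; have := leq_coord_nrm (vec e) i; rewrite nrm_vec.
  by move: (vec e ord0 i) => z; rewrite -[1]/(1%:~R) ler_int; lia.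
have : \sum_(e : dir d) expR (c * (vec e ord0 i)%:~R) <=
    \sum_(e : dir d) (1 + 2 * c ^+ 2 + c * (vec e ord0 i)%:~R).
  apply: ler_sum => e _; have := v1 e; set z : R := _%:~R => z1.
  apply: le_trans (expR_quad _) _.
    by rewrite normrM; apply: le_trans c1; rewrite ler_piMr.
  rewrite addrAC lerD2r lerD2l ler_wpM2l // exprMn ler_piMr ?sqr_ge0 //.
  by rewrite -real_normK ?num_real // exprn_ile1.
rewrite big_split /= sumr_const card_dir -mulr_sumr.
rewrite sum_vec mulr0 addr0 -[_ *+ _]mulr_natl => h.
rewrite mulrC ler_pdivrMr ?ltr0n; last lia.
by rewrite mulrC.
Qed.

Lemma steps_expR m (c : R) (i : 'I_d) : `|c| <= 1 / 2 ->
  steps m (fun u => expR (c * (u ord0 i)%:~R)) 0 <= (1 + 2 * c ^+ 2) ^+ m.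
Proof.
move=> c1; have p0 : 0 <= 1 + 2 * c ^+ 2 by rewrite addr_ge0 // mulr_ge0 ?sqr_ge0.
suff h x : steps m (fun u => expR (c * (u ord0 i)%:~R)) x <=
    (1 + 2 * c ^+ 2) ^+ m * expR (c * (x ord0 i)%:~R).
  by apply: le_trans (h 0) _; rewrite mxE mulr0 expR0 mulr1.
elim: m x => [|m IH] x; first by rewrite expr0 mul1r.
rewrite stepsS; apply: le_trans (steps_le 1 x IH) _.
rewrite steps_scale (exprSr _ m) -mulrA ler_wpM2l ?(exprn_ge0 _ p0) //.
exact: step_expR.
Qed.

Definition Ctail : R := 2 * d%:R * expR 1 * (2 * d%:R ^+ 2) ^+ d.

(** Exponential Markov inequality in each coordinate and sign, at a rate [c] of order [m^(-1/2)] for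
    which the exponential moment stays below [expR 1]. Only polynomial decay of order [d] is
    retained. *)
Lemma heat_tail m t : (0 < t)%N ->
  steps m (fun u => (t <= nrm u)%:R) 0 <= Ctail * rt m.+1 ^+ d / t%:R ^+ d.
Proof.
move=> t0; have s0 := rt_gt0 m; have s1 := rt_ge1 m.
set s := rt m.+1 in s0 s1 *.
pose c := (2 * s)^-1 : R.
have c0 : 0 < c by rewrite invr_gt0 mulr_gt0.
have d0 : 0 < d%:R :> R by rewrite ltr0n.
have t0' : 0 < t%:R :> R by rewrite ltr0n.
have c1 : `|c| <= 1 / 2.
  by rewrite gtr0_norm // div1r lef_pV2 ?posrE ?mulr_gt0 // ler_peMr.
have cm : (1 + 2 * c ^+ 2) ^+ m <= expR 1.
  apply: le_trans (_ : expR (2 * c ^+ 2) ^+ m <= _).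
    by rewrite lerXn2r ?nnegrE ?expR_ge0 ?expR_ge1Dx // addr_ge0 // mulr_ge0 ?sqr_ge0.
  rewrite -expRM_natl ler_expR -mulr_natl /c exprVn exprMn sqr_rt.
  have m0 : 0 < m.+1%:R :> R by rewrite ltr0n.
  rewrite mulrA ler_pdivrMr ?mulr_gt0 ?exprn_gt0 // -natr1; have := ler0n R m; lra.
pose W u := \sum_(i < d) (expR (c * (u ord0 i)%:~R) + expR (- c * (u ord0 i)%:~R)).
have SW : steps m W 0 <= 2 * d%:R * expR 1.
  rewrite steps_sum; apply: le_trans (_ : \sum_(i < d) (expR 1 + expR 1) <= _).
    apply: ler_sum => i _; rewrite steps_add lerD //.
      by apply: le_trans cm; apply: steps_expR.
    by apply: le_trans cm; rewrite -(sqrrN c); apply: steps_expR; rewrite normrN.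
  by rewrite sumr_const card_ord -[_ *+ d]mulr_natl le_eqVlt; apply/orP; left; apply/eqP; ring.
(* Some coordinate is at least [t / d] in absolute value, and [expR (c * t / d)] is the [d]-th power
   of [expR (c * t / d^2)], which exceeds [c * t / d^2]. *)
set q : R := (c * t%:R / d%:R ^+ 2) ^+ d.
have q0 : 0 < q by rewrite exprn_gt0 // divr_gt0 ?mulr_gt0 ?exprn_gt0.
have Wq u : q * (t <= nrm u)%:R <= W u.
  have e0 (i : 'I_d) : 0 <= expR (c * (u ord0 i)%:~R) + expR (- c * (u ord0 i)%:~R).
    by rewrite addr_ge0 ?expR_ge0.
  case: leqP => h; last by rewrite mulr0 sumr_ge0.
  have /existsP[i hi] : [exists i, t <= d * `|u ord0 i|]%N.
    apply: contraLR h => /existsPn h; rewrite -ltnNge.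
    rewrite -(ltn_pmul2l d_gt0) /nrm big_distrr /=.
    rewrite -[d in X in (_ < X)%N]card_ord -sum_nat_const.
    apply: (@leq_ltn_trans (\sum_(i < d) t.-1)).
      by apply: leq_sum => i _; have := h i; lia.
    by rewrite !sum_nat_const card_ord ltn_pmul2l // prednK.
  rewrite mulr1 /W (bigD1 i) //=; apply: ler_wpDr; first by rewrite sumr_ge0.
  have A : c * t%:R / d%:R <= c * `|(u ord0 i)%:~R|.
    by rewrite -mulrA ler_pM2l // ler_pdivrMr // mulrC -intr_norm -natr_absz -natrM ler_nat.
  apply: le_trans (_ : expR (c * `|(u ord0 i)%:~R|) <= _); last first.
    case: ger0P => _; first by rewrite lerDl expR_ge0.
    by rewrite mulrN -mulNr lerDr expR_ge0.
  apply: le_trans (_ : expR (c * t%:R / d%:R) <= _); last by rewrite ler_expR.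
  have -> : c * t%:R / d%:R = d%:R * (c * t%:R / d%:R ^+ 2) by field; rewrite gt_eqF.
  rewrite expRM_natl lerXn2r ?nnegrE ?expR_ge0 //.
    by rewrite divr_ge0 ?mulr_ge0 ?exprn_ge0 // ltW.
  by apply: le_trans (expR_ge1Dx _); rewrite lerDr.
rewrite -(ler_pM2l q0) -steps_scale.
apply: le_trans (steps_le m 0 Wq) _; apply: le_trans SW _.
have [] := (lt0r_neq0 d0, lt0r_neq0 t0', lt0r_neq0 s0) => -[d1 t1] s2.
have -> : q = t%:R ^+ d / ((2 * d%:R ^+ 2) ^+ d * s ^+ d).
  by rewrite /q -exprMn -expr_div_n; congr (_ ^+ _); rewrite /c; field; rewrite d1 s2.
have D1 : (2 * d%:R ^+ 2) ^+ d != 0 :> R by rewrite expf_neq0 // mulf_neq0 ?expf_neq0.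
have [T1 S1] : t%:R ^+ d != 0 :> R /\ s ^+ d != 0 by rewrite !expf_neq0.
rewrite /Ctail le_eqVlt; apply/orP; left; apply/eqP.
move: D1 T1 S1; set X := (2 * _) ^+ d; set Y := t%:R ^+ d; set Z := s ^+ d => D1 T1 S1.
by field; rewrite D1 T1 S1.
Qed.

Definition wt x : R := (nrm x).+1%:R.

Lemma wt_gt0 x : 0 < wt x. Proof. by rewrite ltr0n. Qed.

(** In the convolution of two kernels of time [m], one of [u] and [u - x] has norm at least half
    that of [x]. The tail bound for this factor grows like [m^(d/2)] and the uniform bound for the
    other decays like [m^(-d/2)], so the time cancels. *)
Lemma heat_even_wt m x : x != 0 ->
  heat (2 * m) x <= 2 * Cdiag * Ctail / ((nrm x).+1 %/ 2)%:R ^+ d.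
Proof.
move=> x0; set t := ((nrm x).+1 %/ 2)%N.
have n0 : (0 < nrm x)%N by rewrite lt0n nrm_eq0.
have t0 : (0 < t)%N by rewrite /t; lia.
have Eh : heat (2 * m) x = \sum_(u <- box d (nrm x + m)) heat m (u - x) * heat m (u - 0).
  by rewrite sum_heat // steps_heat subr0 addnn mul2n.
set D := Cdiag / rt m.+1 ^+ d; set tail := fun u : Zd d => (t <= nrm u)%:R : R.
have D0 : 0 <= D by rewrite divr_ge0 ?exprn_ge0 ?rt_ge0 // (le_trans ler01 Cdiag_ge1).
have hm u : heat m u <= D := heat_unif m u.
have key u : heat m (u - x) * heat m (u - 0) <=
    D * (heat m (u - x) * tail (u - x)) + D * (heat m (u - 0) * tail u).
  have [a0 b0] := (@heat_ge0 R d m (u - x), @heat_ge0 R d m (u - 0)).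
  have [a1 b1] := (hm (u - x), hm (u - 0)).
  rewrite /tail; case: (leqP t (nrm u)) => h1; case: (leqP t (nrm (u - x))) => h2;
    rewrite ?mulr1 ?mulr0 ?addr0 ?add0r; [nra|nra|nra|exfalso].
  have := nrmB u (u - x); rewrite opprB addrC subrK; move: h1 h2; rewrite /t; lia.
have tl a : steps m (fun u => tail (u - a)) a = steps m tail 0.
  by rewrite (steps_shift m tail (- a)) subrr.
have T := heat_tail m t0.
have P : heat (2 * m) x <= D * steps m tail 0 + D * steps m tail 0.
  rewrite Eh; apply: le_trans (ler_sum _ (fun u _ => key u)) _.
  rewrite big_split -!mulr_sumr lerD // ler_wpM2l //.
    by rewrite -(tl x); apply: sum_heat_le => y; rewrite ler0n.
  by apply: sum_heat_le => y; rewrite ler0n.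
apply: le_trans P _; rewrite -mulr2n -[_ *+ 2]mulr_natl.
apply: le_trans (_ : 2 * (D * (Ctail * rt m.+1 ^+ d / t%:R ^+ d)) <= _).
  by rewrite !ler_wpM2l.
rewrite le_eqVlt; apply/orP; left; apply/eqP; rewrite /D.
by field; rewrite !expf_neq0 ?gt_eqF ?rt_gt0 ?ltr0n.
Qed.

Definition Cwt : R := (2 * Cdiag * Ctail + 1) * 8 ^+ d.

Lemma Ctail_ge0 : 0 <= Ctail.
Proof. by rewrite /Ctail !mulr_ge0 ?expR_ge0 ?exprn_ge0 ?mulr_ge0 ?exprn_ge0. Qed.

Lemma Cwt_ge1 : 1 <= Cwt.
Proof.
have := Ctail_ge0; have := Cdiag_ge1; have := @exprn_ege1 R d 8 ltac:(lra).
rewrite /Cwt; set p := _ ^+ d => h1 h2 h3.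
have : 0 <= Cdiag * Ctail by rewrite mulr_ge0 //; lra.
nra.
Qed.

Lemma heat_wt n x : heat n x <= Cwt / wt x ^+ d.
Proof.
have B0 : 0 <= 2 * Cdiag * Ctail.
  by rewrite !mulr_ge0 ?Ctail_ge0 // (le_trans ler01 Cdiag_ge1).
have [h|h] := leqP (nrm x).+1 2.
  apply: le_trans (heat_le1 d_gt0 _ _) _.
  rewrite ler_pdivlMr ?exprn_gt0 ?wt_gt0 // mul1r /Cwt.
  apply: le_trans (_ : 8 ^+ d <= _); last by rewrite ler_peMl ?exprn_ge0 //; lra.
  by rewrite lerXn2r ?nnegrE // /wt ?ler0n //; apply: (@le_trans _ _ 2%:R); rewrite ler_nat.
(* An odd time is one step before an even time at a neighbour of [x]; hence the slack of one between
   the norms. *)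
suff ev m (y : Zd d) : (nrm x <= (nrm y).+1)%N -> heat (2 * m) y <= Cwt / wt x ^+ d.
  have [->|->] : (n = 2 * (n %/ 2) \/ n = (2 * (n %/ 2)).+1)%N by lia.
    exact: ev.
  rewrite /heat stepsS -/(heat _); set q := (n %/ 2)%N.
  have A (u : dir d) : heat (2 * q) (x + vec u) <= Cwt / wt x ^+ d.
    by apply: ev; have := nrmB (x + vec u) (vec u); rewrite addrK nrm_vec; lia.
  have <- : step (fun=> Cwt / wt x ^+ d) x = Cwt / wt x ^+ d := steps_cst d_gt0 1 _ x.
  by rewrite /step ler_wpM2l ?invr_ge0 // ler_sum.
move=> xy; have y0 : y != 0 by rewrite -nrm_eq0; lia.
apply: le_trans (heat_even_wt m y0) _; set t := ((nrm y).+1 %/ 2)%N.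
have t0 : 0 < t%:R :> R by rewrite ltr0n /t; lia.
rewrite ler_pdivrMr ?exprn_gt0 // [leRHS]mulrAC ler_pdivlMr ?exprn_gt0 ?wt_gt0 //.
rewrite /Cwt -[leRHS]mulrA -exprMn; apply: ler_pM => //; first by rewrite exprn_ge0 // ltW ?wt_gt0.
  by rewrite lerDl.
rewrite lerXn2r ?nnegrE ?mulr_ge0 ?ler0n //.
by rewrite /wt -natrM ler_nat /t; lia.
Qed.

(* [rt n ^- 3] is dominated by twice an increment of [rt n ^-1]. *)
Lemma sum_rt_tail r M : (0 < r)%N ->
  \sum_(r ^ 2 <= n < M) (rt n.+1 ^+ 3)^-1 <= 2 / r%:R.
Proof.
move=> r0; have r0' : 0 < r%:R :> R by rewrite ltr0n.
have [h|h] := leqP M (r ^ 2); first by rewrite big_geq // divr_ge0 // ltW.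
suff : \sum_(r ^ 2 <= n < M) (rt n.+1 ^+ 3)^-1 <= 2 / r%:R - 2 / rt M.
  by move/le_trans; apply; rewrite lerBlDr lerDl divr_ge0 ?rt_ge0.
elim: M {h}(ltnW h) => [|M IH]; first by rewrite leqn0 expn_eq0 eqn0Ngt r0.
rewrite leq_eqVlt ltnS => /orP[/eqP <-|h]; last first.
  rewrite big_nat_recr //=; move: (IH h).
  have {h} : (0 < M)%N by apply: leq_trans h; rewrite expn_gt0 r0.
  case: M {IH} => // M _.
  have [a0 b0] := (rt_gt0 M, rt_gt0 M.+1).
  have := sqr_rt M.+1; have := sqr_rt M.+2; have := ler_rt (leqnSn M.+1).
  rewrite -[M.+2%:R]natr1; set a := rt M.+1 in a0 *; set b := rt M.+2 in b0 *.
  move=> ab bE aE.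
  suff : (b ^+ 3)^-1 <= 2 / a - 2 / b by lra.
  rewrite -subr_ge0.
  have -> : 2 / a - 2 / b - (b ^+ 3)^-1 = (2 * b ^+ 2 * (b - a) - a) / (a * b ^+ 3).
    by field; rewrite !gt_eqF.
  rewrite divr_ge0 ?mulr_ge0 ?exprn_ge0 ?(ltW a0) ?(ltW b0) //.
  have s0 : 0 < a + b by rewrite addr_gt0.
  rewrite -(pmulr_lge0 _ s0).
  have -> : (2 * b ^+ 2 * (b - a) - a) * (a + b) = 2 * b ^+ 2 * (b ^+ 2 - a ^+ 2) - a * (a + b) by ring.
  rewrite bE aE; nra.
by rewrite big_geq // rt_sqr subrr.
Qed.

(** The weight [n.+1 ^ k.-1] bounds the number of [k]-tuples of times of sum [n]. Below [n = r^2]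
    the bound in [r] and the number of terms give [r^(2k-d)]; above it, [d >= 2k + 1] leaves the
    summable [n^(-3/2)] after extracting [e = d - 2k - 1] powers of [r]. *)
Lemma sum_green k r (A : R) F M : (0 < k)%N -> (2 * k < d)%N -> (0 < r)%N ->
  0 <= A -> (forall n, 0 <= F n) ->
  (forall n, F n <= A / r%:R ^+ d) -> (forall n, F n <= A / rt n.+1 ^+ d) ->
  \sum_(0 <= n < M) n.+1%:R ^+ k.-1 * F n <= 3 * A * r%:R ^+ (2 * k) / r%:R ^+ d.
Proof.
move=> k0 kd r0 A0 F0 F1 F2; have r0' : 0 < r%:R :> R by rewrite ltr0n.
pose t n := n.+1%:R ^+ k.-1 * F n.
have t_ge0 n : 0 <= t n by rewrite mulr_ge0 ?exprn_ge0.
have [e de] : exists e, d = (2 * k + 1 + e)%N by exists (d - (2 * k + 1))%N; lia.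
have h1 : \sum_(0 <= n < r ^ 2) t n <= A * r%:R ^+ (2 * k) / r%:R ^+ d.
  apply: le_trans (_ : \sum_(0 <= n < r ^ 2) ((r ^ 2)%:R ^+ k.-1 * (A / r%:R ^+ d)) <= _).
    rewrite !big_nat; apply: ler_sum => n /= nr.
    by rewrite ler_pM ?exprn_ge0 // lerXn2r ?nnegrE ?ler0n // ler_nat.
  rewrite sumr_const_nat subn0 -[_ *+ (r ^ 2)]mulr_natl mulrA -exprS prednK //.
  by rewrite natrX -exprM mulrCA mulrA.
have h2 : \sum_(r ^ 2 <= n < maxn M (r ^ 2)) t n <= 2 * A * r%:R ^+ (2 * k) / r%:R ^+ d.
  apply: le_trans (_ : \sum_(r ^ 2 <= n < maxn M (r ^ 2)) (A / r%:R ^+ e * (rt n.+1 ^+ 3)^-1) <= _).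
    rewrite !big_nat; apply: ler_sum => n /= /andP[nr _].
    apply: le_trans (_ : n.+1%:R ^+ k.-1 * (A / rt n.+1 ^+ d) <= _).
      by rewrite ler_wpM2l ?exprn_ge0.
    have s0 := rt_gt0 n; rewrite -sqr_rt -exprM.
    set s := rt n.+1 in s0 *.
    have -> : s ^+ (2 * k.-1) * (A / s ^+ d) = A / s ^+ e * (s ^+ 3)^-1.
      rewrite de (_ : 2 * k + 1 + e = 2 * k.-1 + e + 3)%N; last lia.
      by rewrite !exprD; field; rewrite !expf_neq0 // gt_eqF.
    rewrite ler_wpM2r ?invr_ge0 ?exprn_ge0 ?(ltW s0) // ler_wpM2l //.
    rewrite lef_pV2 ?posrE ?exprn_gt0 // lerXn2r ?nnegrE ?(ltW s0) ?ler0n //.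
    by rewrite -rt_sqr ler_rt // ltnW.
  rewrite -mulr_sumr; apply: le_trans (_ : A / r%:R ^+ e * (2 / r%:R) <= _).
    by rewrite ler_wpM2l ?divr_ge0 ?exprn_ge0 ?sum_rt_tail ?ler0n.
  rewrite le_eqVlt; apply/orP; left; apply/eqP; rewrite de !exprD expr1.
  by field; rewrite !expf_neq0 ?gt_eqF.
have h3 : \sum_(0 <= n < M) t n <= \sum_(0 <= n < maxn M (r ^ 2)) t n.
  rewrite [leRHS](big_cat_nat (n := M)) ?leq_maxl //= lerDl sumr_ge0 //.
apply: le_trans h3 _; rewrite (big_cat_nat (n := r ^ 2)) ?leq_maxr //=.
move: (lerD h1 h2); move/le_trans; apply.
by rewrite le_eqVlt; apply/orP; left; apply/eqP; ring.
Qed.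

End UpperBounds.

Arguments Cdiag R d : clear implicits.
Arguments Cwt R d : clear implicits.

(** * Near-diagonal lower bounds *)

Section LowerBounds.
Context {R : realType} {d : nat}.
Hypothesis d_gt0 : (0 < d)%N.
Implicit Types (x y a b u : Zd d).
Local Notation heat := (@heat R d).
Local Notation ret := (@ret R d).
Local Notation heat3 := (@heat3 R d).
Local Notation drop_ret := (@drop_ret R d).

Let q x : R := \sum_(i < d) (x ord0 i)%:~R ^+ 2.

Lemma steps_sqr m x : steps m q x = q x + m%:R.
Proof.
elim: m x => [|m IH] x; first by rewrite addr0.
rewrite stepsS (eq_step _ IH) /step.
have sq e : q (x + vec e) = q x + 1 + \sum_(i < d) ((x ord0 i)%:~R + (x ord0 i)%:~R) * (vec e ord0 i)%:~R.
  have v1 : \sum_(i < d) (vec e ord0 i)%:~R ^+ 2 = 1 :> R.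
    rewrite (bigD1 e.1) //= big1 => [|i ie]; last by rewrite vecE (negPf ie) mulr0 expr0n.
    by rewrite vecE eqxx mulr1; case: e.2; rewrite /= ?expr1 ?expr0 ?intrN ?sqrrN expr1n addr0.
  rewrite -[X in _ + X + _]v1 /q -!big_split; apply: eq_bigr => i _ /=.
  by rewrite mxE intrD; ring.
under eq_bigr => e _ do rewrite sq.
rewrite !big_split /= [X in _ + X + _]exchange_big [X in _ + X + _]big1 ?addr0; last first.
  by move=> i _ /=; rewrite -mulr_sumr sum_vec mulr0.
rewrite !sumr_const card_dir -!mulrnDl -[(_ + _) *+ _]mulr_natl.
rewrite mulKf; last by rewrite pnatr_eq0; lia.
by rewrite -natr1 addrAC -addrA.
Qed.

(** By Chebyshev and [steps_sqr] the walk is in the box of radius [2 * r] with probability at least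
    [3/4]. Cauchy-Schwarz, written as a pointwise Young inequality with weight [V] the volume of the
    box, converts this mass into a lower bound on the squared l^2 norm, which is [ret m]. *)
Lemma ret_lower m r : (0 < r)%N -> (m <= r ^ 2)%N ->
  (2 * (4 * r).+1%:R ^+ d)^-1 <= ret m.
Proof.
move=> r0 mr; have r0' : 0 < r%:R :> R by rewrite ltr0n.
set V : R := (4 * r).+1%:R ^+ d.
have V0 : 0 < V by rewrite exprn_gt0 ?ltr0n.
pose B u : R := (u \in box d (2 * r))%:R.
have qB u : 1 <= B u + (4 * r%:R ^+ 2)^-1 * q u.
  rewrite /B; case: (boolP (u \in _)) => h.
    by rewrite lerDl mulr_ge0 ?invr_ge0 ?mulr_ge0 ?exprn_ge0 // sumr_ge0 // => i _; rewrite sqr_ge0.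
  have /existsP[i hi] : [exists i, 2 * r < `|u ord0 i|]%N.
    apply: contraR h => /existsPn h; apply/mem_boxP => i.
    by have := h i; rewrite -leqNgt.
  rewrite add0r mulrC ler_pdivlMr ?mulr_gt0 ?exprn_gt0 // mul1r.
  rewrite /q (bigD1 i) //=; apply: ler_wpDr; first by rewrite sumr_ge0 // => j _; rewrite sqr_ge0.
  rewrite -[leRHS]real_normK ?num_real // -intr_norm -natr_absz -!natrX -natrM ler_nat.
  by rewrite -[4%N]/(2 ^ 2)%N -expnMn leq_exp2r // ltnW.
have S : 3 / 4 <= steps m B 0.
  have : @steps R d m (fun=> 1) 0 <= steps m B 0 + (4 * r%:R ^+ 2)^-1 * m%:R.
    have -> : m%:R = steps m q 0.
      by rewrite steps_sqr /q big1 ?add0r // => i _; rewrite mxE expr0n.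
    by rewrite -steps_scale -steps_add; apply: steps_le.
  rewrite steps_cst //.
  have : (4 * r%:R ^+ 2)^-1 * m%:R <= 1 / 4 :> R.
    rewrite mulrC ler_pdivrMr ?mulr_gt0 ?exprn_gt0 // mulrA div1r mulVf // mul1r.
    by rewrite -natrX ler_nat.
  lra.
have E : steps m B 0 = \sum_(u <- box d (2 * r + d * (2 * r) + m)) heat m (u - 0) * B u.
  by rewrite sum_heat // nrm0; lia.
have Er : ret m = \sum_(u <- box d (2 * r + d * (2 * r) + m)) heat m (u - 0) * heat m (u - 0).
  by rewrite sum_heat ?nrm0 ?steps_heat ?subr0 ?addnn -?mul2n //; lia.
have EB : \sum_(u <- box d (2 * r + d * (2 * r) + m)) B u <= V.
  have -> : V = \sum_(u <- box d (2 * r)) 1.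
    rewrite big_const_seq count_predT size_box iter_addr addr0 natrX.
    by congr (_%:R ^+ _); lia.
  under eq_bigr do rewrite /B mulrb.
  rewrite -big_mkcond -big_filter le_eqVlt; apply/orP; left; apply/eqP/perm_big.
  apply: uniq_perm; rewrite ?filter_uniq ?box_uniq // => u.
  rewrite mem_filter; case: (boolP (u \in box d (2 * r))) => // /nrm_box uK.
  by rewrite mem_box //; lia.
have : steps m B 0 <= 2^-1 * (V * ret m) + 2^-1 * (V^-1 * V).
  apply: le_trans (_ : 2^-1 * (V * ret m) + 2^-1 * (V^-1 *
     \sum_(u <- box d (2 * r + d * (2 * r) + m)) B u) <= _).
    rewrite E Er !mulr_sumr -big_split ler_sum //= => u _.
    have -> : B u = B u ^+ 2 by rewrite /B; case: (u \in _); rewrite ?expr1n ?expr0n.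
    set s := heat _ _; set t := B u; rewrite -subr_ge0.
    have -> : 2^-1 * (V * (s * s)) + 2^-1 * (V^-1 * t ^+ 2) - s * t ^+ 2 =
       2^-1 * (V^-1 * (V * s - t ^+ 2) ^+ 2) + 2^-1 * V^-1 * t ^+ 2 * (1 - t ^+ 2).
      by field; rewrite gt_eqF.
    apply: addr_ge0; first by rewrite mulr_ge0 ?invr_ge0 // mulr_ge0 ?sqr_ge0 ?invr_ge0 ?(ltW V0).
    rewrite /t /B; case: (u \in _); rewrite ?expr1n ?subrr ?mulr0 //.
    by rewrite expr0n /= mulr0 mul0r.
  by rewrite lerD2l !ler_wpM2l ?invr_ge0 ?(ltW V0).
rewrite mulVf ?gt_eqF // mulr1 => U.
rewrite invfM ler_pdivrMr // (mulrC (ret m) V). lra.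
Qed.

(** At times above a large multiple of [(nrm x)^2], moving from [0] to [x] costs by [heat3_drop] at
    most half of the return probability. The upper end of the time window leaves room for the sums
    of [N] clocks in [green_lower]. *)
Lemma heat3_lower (N : nat) : (0 < N)%N -> exists (T : nat) (c : R),
  [/\ (0 < T)%N, 0 < c & forall x j,
   (T * (nrm x).+1 ^ 2 <= j <= 8 * N * T * (nrm x).+1 ^ 2)%N ->
   c / (nrm x).+1%:R ^+ d <= heat3 (2 * j) x].
Proof.
move=> N0; have [L LE] : exists L, L = Ldiag d by exists (Ldiag d).
have L0 : (0 < L)%N by rewrite LE Ldiag_gt0.
have [Q QE] : exists Q, Q = ((20 * N * L) ^ d)%N by eexists.
have Q0 : (0 < Q)%N by rewrite QE expn_gt0 !muln_gt0 N0 L0.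
(* [Q], chosen independently of [M], bounds the ratio of [(M * r)^(-d)] to the return probability
   over the whole window. The loss in [heat3_drop] is at most [16 * d / M] times [(M * r)^(-d)], and
   [M = 16 * d * 4 * Q] makes this half of the main term. *)
have [M ME] : exists M, M = (64 * d * Q)%N by eexists.
have M0 : (0 < M)%N by rewrite ME !muln_gt0 d_gt0 Q0.
have Qr : 0 < Q%:R :> R by rewrite ltr0n.
have Mr : 0 < M%:R ^+ d :> R by rewrite exprn_gt0 ?ltr0n.
exists (L * M ^ 2)%N, ((4 * Q%:R)^-1 / M%:R ^+ d); split.
- by rewrite muln_gt0 L0 expn_gt0 M0.
- by rewrite divr_gt0 // invr_gt0 mulr_gt0.
move=> x j; set r := (nrm x).+1 => /andP[j1 j2].
have rr : 0 < r%:R ^+ d :> R by rewrite exprn_gt0 ?ltr0n.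
have j0 : (0 < j)%N by apply: leq_trans j1; rewrite !muln_gt0 L0 ?expn_gt0 ?M0.
have jr : 0 < j%:R :> R by rewrite ltr0n.
have h1 : ret j <= 8 / (M * r)%:R ^+ d.
  by apply: ret_upper; rewrite // ?muln_gt0 ?M0 // expnMn mulnA -LE.
have h2 := mul_drop_ret d_gt0 j : j%:R * drop_ret (2 * j) <= ret j.
have h3 := @heat3_drop R d d_gt0 (2 * j) x.
have h4 : (2 * (4 * (4 * N * L * M * r)).+1%:R ^+ d)^-1 <= ret (2 * j).
  apply: ret_lower; first by rewrite !muln_gt0 N0 L0 M0.
  apply: leq_trans (_ : 2 * (8 * N * (L * M ^ 2) * r ^ 2) <= _)%N; first by rewrite leq_mul2l.
  rewrite !expnMn; have : (N <= N ^ 2)%N by rewrite -{1}(expn1 N) leq_pexp2l.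
  have : (L <= L ^ 2)%N by rewrite -{1}(expn1 L) leq_pexp2l.
  move: (N ^ 2)%N (L ^ 2)%N => N' L' LL NN.
  have : (N * L <= N' * L')%N by rewrite leq_mul.
  move=> /(leq_mul (leqnn (16 * M ^ 2 * r ^ 2)%N)); lia.
have h5 := ret_ge0 (2 * j).+1 : 0 <= ret (2 * j).+1.
have h6 : (2 * Q%:R * (M%:R ^+ d * r%:R ^+ d))^-1 <= ret (2 * j).
  apply: le_trans h4; rewrite lef_pV2 ?posrE ?mulr_gt0 ?exprn_gt0 ?ltr0n //.
  rewrite -mulrA ler_wpM2l // QE natrX -!exprMn lerXn2r ?nnegrE ?mulr_ge0 ?ler0n //.
  rewrite -!natrM ler_nat.
  have : (0 < N * L * M * r)%N by rewrite !muln_gt0 N0 L0 M0.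
  move: N0 => _; rewrite !mulnA.
  rewrite (_ : 4 * 4 * N * L * M * r = 16 * (N * L * M * r))%N; last by rewrite !mulnA.
  rewrite (_ : 20 * N * L * M * r = 20 * (N * L * M * r))%N; last by rewrite !mulnA.
  lia.
have h7 : (nrm x)%:R ^+ 2 * (2 * d)%:R * drop_ret (2 * j) <= (4 * Q%:R * (M%:R ^+ d * r%:R ^+ d))^-1 :> R.
  have D0 := drop_ret_ge0 d_gt0 (2 * j) : 0 <= drop_ret (2 * j) :> R.
  apply: le_trans (_ : r%:R ^+ 2 * (2 * d)%:R * drop_ret (2 * j) <= _ :> R).
    rewrite ler_wpM2r // ler_wpM2r ?ler0n // lerXn2r ?nnegrE ?ler0n //.
    by rewrite ler_nat /r.
  rewrite -(ler_pM2l jr) mulrCA.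
  apply: le_trans (_ : r%:R ^+ 2 * (2 * d)%:R * (8 / (M * r)%:R ^+ d) <= _ :> R).
    by rewrite ler_wpM2l ?mulr_ge0 ?exprn_ge0 ?ler0n // (le_trans h2).
  have jM : M%:R * r%:R ^+ 2 <= j%:R :> R.
    rewrite -natrX -natrM ler_nat; apply: leq_trans j1; rewrite leq_mul2r.
    by rewrite (leq_trans _ (leq_pmull _ L0)) ?orbT // -{1}(expn1 M) leq_pexp2l.
  rewrite (natrM _ M r) exprMn (natrM _ 2 d) (invfM (4 * Q%:R)).
  set w : R := (M%:R ^+ d * r%:R ^+ d)^-1.
  have w0 : 0 < w by rewrite invr_gt0 mulr_gt0.
  have Q4 : 0 < (4 * Q%:R)^-1 :> R by rewrite invr_gt0 mulr_gt0.
  rewrite !mulrA ler_wpM2r ?(ltW w0) //.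
  apply: le_trans (_ : M%:R * r%:R ^+ 2 / (4 * Q%:R) <= _ :> R); last by rewrite ler_wpM2r ?(ltW Q4).
  rewrite le_eqVlt; apply/orP; left; apply/eqP.
  by rewrite ME !natrM; field; rewrite gt_eqF.
have E : (4 * Q%:R)^-1 / M%:R ^+ d / r%:R ^+ d = (4 * Q%:R * (M%:R ^+ d * r%:R ^+ d))^-1 :> R.
  by field; rewrite !gt_eqF.
have E2 : (2 * Q%:R * (M%:R ^+ d * r%:R ^+ d))^-1 = 2 * (4 * Q%:R * (M%:R ^+ d * r%:R ^+ d))^-1 :> R.
  by field; rewrite !gt_eqF.
move: h3; rewrite heat3_0 E; move: h6 h7; rewrite E2; lra.
Qed.

End LowerBounds.

(** * Green functions of additive walks *)

Lemma ler_sum_inj {R : realType} (I J : finType) (A : {pred J}) (B : {pred I})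
    (h : J -> I) (F : I -> R) :
  {in A &, injective h} -> (forall j, j \in A -> h j \in B) ->
  (forall i, 0 <= F i) -> \sum_(j in A) F (h j) <= \sum_(i in B) F i.
Proof.
move=> hI hB F0; rewrite -(big_imset F hI) /=.
rewrite [leRHS](bigID (mem (h @: A))) /= -[leLHS]addr0 lerD ?sumr_ge0 //.
rewrite le_eqVlt; apply/orP; left; apply/eqP/eq_bigl => i /=.
by apply/idP/andP => [/imsetP[j jA ->]|[]//]; rewrite hB // imset_f.
Qed.

Section Green.
Context {R : realType} {d N : nat}.
Hypothesis d_gt0 : (0 < d)%N.
Implicit Types (x y a b u : Zd d) (I : {set 'I_N}).
Local Notation heat := (@heat R d).
Local Notation times K := {ffun 'I_N -> 'I_K.+1}.

Definition tot K (n : times K) : nat := \sum_i n i.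

(** A subfamily of walks keeps the full index type, with the other clocks frozen at [0], so that the
    estimates apply to all walks and to the parts of a split alike. *)
Definition supp_in K I : {set times K} :=
  [set n : times K | [forall i, (i \notin I) ==> (n i == ord0)]].

Lemma supp_inP K I (n : times K) :
  reflect (forall i, i \notin I -> n i = ord0) (n \in supp_in K I).
Proof.
by rewrite inE; apply: (iffP forallP) => h i; [move=> iI; have := h i; rewrite iI => /eqP|
  apply/implyP => /h ->].
Qed.

Lemma leq_tot K (n : times K) i : (n i <= tot n)%N.
Proof. by rewrite /tot (bigD1 i) //= leq_addr. Qed.

(** Given the sum, one clock [i0] in [I] is determined by the others, each of which is at most
    [s]. *)
Lemma card_tot K I s : (0 < #|I|)%N ->
  (#|[set n in supp_in K I | tot n == s]| <= s.+1 ^ #|I|.-1)%N.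
Proof.
move=> /card_gt0P[i0 i0I].
pose h (n : times K) : {ffun 'I_N -> 'I_s.+1} :=
  [ffun i => if i \in I :\ i0 then inord (n i) else ord0].
have -> : (s.+1 ^ #|I|.-1 = #|pffun_on (ord0 : 'I_s.+1) (mem (I :\ i0)) predT|)%N.
  by rewrite card_pffun_on card_ord [#|I|](cardsD1 i0) i0I.
rewrite -(card_in_imset (f := h)); last first.
  have mS (n : times K) : n \in [set n in supp_in K I | tot n == s] ->
    (forall i, i \notin I -> n i = ord0) /\ tot n = s.
    by move=> /finset.setIdP[/supp_inP ? /eqP].
  move=> n n' /mS[sn tn] /mS[sn' tn'] /ffunP hh.
  have out i : i != i0 -> n i = n' i.
    move=> ii0; case: (boolP (i \in I)) => iI; last by rewrite sn ?sn'.
    apply: val_inj; have := congr1 val (hh i); rewrite !ffunE in_setD1 ii0 iI /=.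
    by rewrite !inordK // ltnS; [rewrite -tn'|rewrite -tn]; rewrite leq_tot.
  apply/ffunP => i; have [->|/out //] := eqVneq i i0.
  apply: val_inj; have : tot n = tot n' by rewrite tn tn'.
  rewrite /tot (bigD1 i0) //= [in RHS](bigD1 i0) //=.
  by rewrite (eq_bigr (fun i => nat_of_ord (n' i))) => [/addIn //|j /out ->].
apply: subset_leq_card; apply/fintype.subsetP => f /imsetP[n _ ->].
apply/pffun_onP; split => //; apply/fintype.subsetP => i.
by rewrite !inE ffunE in_setD1; case: ifP.
Qed.

Lemma sum_tot K I (F : nat -> R) : (0 < #|I|)%N -> (forall s, 0 <= F s) ->
  \sum_(n in supp_in K I) F (tot n) <=
  \sum_(0 <= s < (N * K).+1) s.+1%:R ^+ #|I|.-1 * F s.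
Proof.
move=> I0 F0; have tb (n : times K) : (tot n < (N * K).+1)%N.
  rewrite ltnS /tot -[N in leqRHS]card_ord -sum_nat_const leq_sum // => i _.
  by rewrite -ltnS.
rewrite big_mkord (partition_big (fun n => Ordinal (tb n)) xpredT) //=.
apply: ler_sum => s _.
rewrite (eq_bigr (fun=> F s)) => [|n /andP[_ /eqP <-] //].
rewrite sumr_const -[_ *+ _]mulr_natl -natrX ler_wpM2r // ler_nat.
apply: leq_trans (card_tot K s I0); apply: subset_leq_card.
by apply/fintype.subsetP => n /andP[nI /eqP <-]; apply/finset.setIdP.
Qed.

Lemma green_upper K I x : (2 * #|I| < d)%N ->
  \sum_(n in supp_in K I) heat (tot n) x <= 
    3 * (Cwt R d + Cdiag R d) * (nrm x).+1%:R ^+ (2 * #|I|) / (nrm x).+1%:R ^+ d.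
Proof.
Proof.
move=> kd; set r := (nrm x).+1.
have r0 : 0 < r%:R ^+ d :> R by rewrite exprn_gt0 ?ltr0n.
have C1 := @Cwt_ge1 R d d_gt0; have C2 := @Cdiag_ge1 R d d_gt0.
(* The empty family does occur, when one time vector dominates the other in [pair_green]; its Green
   function is [dirac0], outside the scope of [sum_green]. *)
have [I0|I0] := posnP #|I|.
  have I0' : I = finset.set0 by apply/eqP; rewrite -cards_eq0 I0.
  rewrite I0 muln0 expr0 mulr1 (big_pred1 ([ffun=> ord0] : times K)) => [|n]; last first.
    apply/supp_inP/eqP => [h|-> i _]; last by rewrite ffunE.
    by apply/ffunP => i; rewrite ffunE h // I0' finset.in_set0.
  rewrite /tot big1 => [|i _]; last by rewrite ffunE.
  rewrite ler_pdivlMr // /heat /steps /= /dirac0; have [x0|x0] := eqVneq x 0.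
    by rewrite /r x0 nrm0 expr1n mulr1 /=; lra.
  by rewrite mul0r; lra.
apply: le_trans (sum_tot K (F := fun s => heat s x) I0 _) _ => [s|]; first exact: heat_ge0.
apply: sum_green => //.
- by lra.
- by move=> n; apply: heat_ge0.
- move=> n; apply: le_trans (heat_wt d_gt0 n x) _.
  by rewrite ler_wpM2r ?invr_ge0 ?(ltW r0) //; lra.
move=> n; apply: le_trans (heat_unif d_gt0 n x) _.
by rewrite ler_wpM2r ?invr_ge0 ?exprn_ge0 ?rt_ge0 //; lra.
Qed.

(** [sum_green] for the kernel averaged over the box: total mass one gives the bound in [r], and the
    volume at most [(3 * r)^d] times the uniform bound gives the bound in time. *)
Lemma green_ball K I r : (0 < #|I|)%N -> (2 * #|I| < d)%N -> (0 < r)%N ->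
  \sum_(u <- box d r) \sum_(n in supp_in K I) heat (tot n) u <=
    3 * (3 ^+ d * Cdiag R d) * r%:R ^+ (2 * #|I|).
Proof.
move=> I0 kd r0; have r0' : 0 < r%:R ^+ d :> R by rewrite exprn_gt0 ?ltr0n.
have C2 := @Cdiag_ge1 R d d_gt0.
have p3 := @exprn_ege1 R d 3 ltac:(lra).
pose F s : R := (\sum_(u <- box d r) heat s u) / r%:R ^+ d.
have F0 s : 0 <= F s.
  by rewrite divr_ge0 ?(ltW r0') // sumr_ge0 // => u _; rewrite heat_ge0.
have A1 : 1 <= 3 ^+ d * Cdiag R d by rewrite -[leLHS]mulr1 ler_pM.
have h : \sum_(0 <= s < (N * K).+1) s.+1%:R ^+ #|I|.-1 * F s <=
    3 * (3 ^+ d * Cdiag R d) * r%:R ^+ (2 * #|I|) / r%:R ^+ d.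
  apply: sum_green => // [|n|n]; first exact: le_trans ler01 A1.
    rewrite ler_wpM2r ?invr_ge0 ?(ltW r0') //.
    by apply: le_trans (heat_sum_box d_gt0 r n) _.
  rewrite ler_pdivrMr // [leRHS]mulrAC ler_pdivlMr ?exprn_gt0 ?rt_gt0 //.
  have s0 : 0 < rt n.+1 ^+ d :> R by rewrite exprn_gt0 ?rt_gt0.
  rewrite -ler_pdivlMr //.
  apply: le_trans (_ : \sum_(u <- box d r) (Cdiag R d / rt n.+1 ^+ d) <= _).
    by apply: ler_sum => u _; apply: heat_unif.
  rewrite big_const_seq count_predT size_box iter_addr addr0 -[_ *+ _]mulr_natl.
  rewrite mulrA ler_wpM2r ?invr_ge0 ?(ltW s0) // [leRHS]mulrAC.
  rewrite ler_wpM2r ?(le_trans ler01 C2) //.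
  by rewrite natrX -exprMn lerXn2r ?nnegrE // ?ler0n // -natrM ler_nat; lia.
rewrite exchange_big /=.
have -> : \sum_(n in supp_in K I) \sum_(u <- box d r) heat (tot n) u =
    r%:R ^+ d * \sum_(n in supp_in K I) F (tot n).
  by rewrite mulr_sumr; apply: eq_bigr => n _; rewrite /F mulrC divfK ?gt_eqF.
rewrite mulrC -ler_pdivlMr //; apply: le_trans (sum_tot K I0 F0) h.
Qed.

(** About [r^2] values for each clock give [r^(2N)] time vectors at which the kernel has order
    [r^(-d)]. Parity forbids a bound at a single total time, so three families are assembled into
    [heat3], whose total weight is the [4] lost in the constant. *)
Lemma green_lower : (0 < N)%N -> exists (T : nat) (c : R), [/\ (0 < T)%N, 0 < c &
  forall K x, (T * (nrm x).+1 ^ 2 <= K)%N ->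
    c * (nrm x).+1%:R ^+ (2 * N) / (nrm x).+1%:R ^+ d <=
    \sum_(n : times K) heat (tot n) x].
Proof.
move=> N0; have [T [c [T0 c0 h]]] := @heat3_lower R d d_gt0 N N0.
exists (11 * T)%N, (c / 4); split => //; [by rewrite muln_gt0|by lra|].
move=> K x; set r := (nrm x).+1 => TK.
have r2 : (0 < r ^ 2)%N by rewrite expn_gt0.
pose M := (T * r ^ 2)%N.
have M0 : (0 < M)%N by rewrite muln_gt0 T0.
have MK : (8 * M + 3 <= K)%N by apply: leq_trans TK; rewrite /M; lia.
pose i0 := Ordinal N0.
(* The clocks are multiples of [4], and [t] in [0, 1, 2] is added to a single one, so the total
   times [4 * j + t] are those occurring in [heat3 (2 * j)]. *)
pose phi t (m : {ffun 'I_N -> 'I_M}) : times K :=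
  [ffun i => inord (4 * (M + m i) + (if i == i0 then t else 0))%N].
have phiE t (m : {ffun 'I_N -> 'I_M}) i : (t <= 2)%N ->
    phi t m i = (4 * (M + m i) + (if i == i0 then t else 0))%N :> nat.
  by move=> t2; rewrite ffunE inordK //; have := ltn_ord (m i); case: ifP; lia.
pose j (m : {ffun 'I_N -> 'I_M}) := (\sum_i (M + m i))%N.
have tphi t m : (t <= 2)%N -> tot (phi t m) = (4 * j m + t)%N.
  move=> t2; rewrite /tot (eq_bigr _ (fun i _ => phiE t m i t2)) big_split /=.
  by rewrite -big_distrr /= -big_mkcond /= big_pred1_eq.
have jm m : (M <= j m <= 8 * N * M)%N.
  apply/andP; split; first by rewrite /j (bigD1 i0) //=; lia.
  rewrite /j; apply: (@leq_trans (\sum_(i < N) (2 * M))%N).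
    by apply: leq_sum => i _; have := ltn_ord (m i); lia.
  by rewrite sum_nat_const card_ord; lia.
have le t : (t <= 2)%N -> \sum_(m : {ffun 'I_N -> 'I_M}) heat (4 * j m + t) x <=
    \sum_(n : times K) heat (tot n) x.
  move=> t2; rewrite (eq_bigr _ (fun m _ => congr1 (heat^~ x) (esym (tphi t m t2)))).
  apply: (ler_sum_inj (A := predT) (B := predT) (h := phi t) (F := fun n => heat (tot n) x)) => //.
    move=> m m' _ _ /ffunP E; apply/ffunP => i; apply: val_inj.
    by have := congr1 val (E i); rewrite /= !phiE //; lia.
  by move=> n; apply: heat_ge0.
have low : (M ^ N)%:R * (c / r%:R ^+ d) <= \sum_(m : {ffun 'I_N -> 'I_M}) heat3 (2 * j m) x.
  have -> : (M ^ N)%:R * (c / r%:R ^+ d) = \sum_(m : {ffun 'I_N -> 'I_M}) (c / r%:R ^+ d).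
    by rewrite sumr_const card_ffun !card_ord mulr_natl.
  by apply: ler_sum => m _; apply: h; have := jm m; rewrite /M -/r; lia.
have := le 0%N isT; have := le 1%N isT; have := le 2%N isT.
move: low; rewrite /heat3 !big_split /= -mulr_sumr => low l2 l1 l0.
rewrite (eq_bigr (fun m => heat (2 * (2 * j m)) x)) in l0; last first.
  by move=> m _; rewrite addn0 mulnA.
rewrite (eq_bigr (fun m => heat (2 * (2 * j m)).+1 x)) in l1; last first.
  by move=> m _; rewrite addn1 mulnA.
rewrite (eq_bigr (fun m => heat (2 * (2 * j m)).+2 x)) in l2; last first.
  by move=> m _; rewrite addn2 mulnA.
have : (M ^ N)%:R * (c / r%:R ^+ d) >= c * r%:R ^+ (2 * N) / r%:R ^+ d.
  rewrite mulrCA -mulrA ler_wpM2l ?(ltW c0) // ler_wpM2r ?invr_ge0 ?exprn_ge0 //.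
  rewrite exprM -!natrX ler_nat leq_exp2r // /M leq_pmull //.
rewrite mulrAC (mulrAC _ 4^-1) (mulrAC c); lra.
Qed.

End Green.

(** * Green function of a pair of time vectors *)

Section PairSum.
Context {R : realType} {d N : nat}.
Hypothesis d_gt0 : (0 < d)%N.
Hypothesis N_gt0 : (0 < N)%N.
Hypothesis Nd : (2 * N < d)%N.
Implicit Types (x y a b u : Zd d) (I : {set 'I_N}).
Local Notation heat := (@heat R d).
Local Notation times K := {ffun 'I_N -> 'I_K.+1}.

(* [r ^ (2k - d)], the order of the Green function of [k] walks at distance [r]. *)
Definition decay (k r : nat) : R := r%:R ^+ (2 * k) / r%:R ^+ d.

Lemma decay_ge0 k r : 0 <= decay k r.
Proof. by rewrite divr_ge0 ?exprn_ge0. Qed.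

Lemma decayE k r : (2 * k <= d)%N -> (0 < r)%N ->
  decay k r = (r%:R ^+ (d - 2 * k))^-1.
Proof.
move=> kd r0; have r0' : r%:R != 0 :> R by rewrite pnatr_eq0 -lt0n.
have E : r%:R ^+ d = r%:R ^+ (2 * k) * r%:R ^+ (d - 2 * k) :> R by rewrite -exprD subnKC.
by rewrite /decay E invfM mulrA divff ?mul1r // expf_neq0.
Qed.

Lemma decay_anti k r s : (2 * k <= d)%N -> (0 < r)%N -> (r <= s)%N ->
  decay k s <= decay k r.
Proof.
move=> kd r0 rs; rewrite !decayE ?(leq_trans r0) //.
rewrite lef_pV2 ?posrE ?exprn_gt0 ?ltr0n ?(leq_trans r0) //.
by rewrite lerXn2r ?nnegrE ?ler0n // ler_nat.
Qed.

Lemma decay_scale k q r s : (2 * k <= d)%N -> (0 < r)%N -> (0 < s)%N ->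
  (s <= q * r)%N -> decay k r <= q%:R ^+ d * decay k s.
Proof.
move=> kd r0 s0 sq; have q0 : (0 < q)%N by case: q sq => //; lia.
have [q0' r0'] : 0 < q%:R :> R /\ 0 < r%:R :> R by rewrite !ltr0n.
apply: le_trans (_ : q%:R ^+ d * decay k (q * r) <= _); last first.
  by rewrite ler_wpM2l ?exprn_ge0 ?decay_anti.
rewrite /decay natrM !exprMn invfM.
have -> : q%:R ^+ d * (q%:R ^+ (2 * k) * r%:R ^+ (2 * k) * ((q%:R ^+ d)^-1 / r%:R ^+ d)) =
   q%:R ^+ (2 * k) * (r%:R ^+ (2 * k) / r%:R ^+ d) :> R.
  by field; rewrite !expf_neq0 ?gt_eqF.
by rewrite ler_peMl ?decay_ge0 // exprn_ege1 // ler1n.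
Qed.

Let Cg : R := 3 * (Cwt R d + Cdiag R d).

Lemma Cg_ge0 : 0 <= Cg.
Proof.
have := @Cwt_ge1 R d d_gt0; have := @Cdiag_ge1 R d d_gt0; rewrite /Cg; lra.
Qed.

Let card_lt I : (2 * #|I| < d)%N.
Proof.
have : (#|I| <= N)%N by rewrite -[leqRHS]card_ord max_card.
lia. Qed.

Lemma green_decay K I x r : (0 < r)%N -> (r <= (nrm x).+1)%N ->
  \sum_(n in supp_in K I) heat (tot n) x <= Cg * decay #|I| r.
Proof.
move=> r0 rx; apply: le_trans (green_upper d_gt0 K x (card_lt I)) _.
rewrite -/Cg -mulrA ler_wpM2l ?Cg_ge0 // decay_anti //.
by rewrite ltnW ?card_lt.
Qed.

Lemma sum_supp_setT K (F : times K -> R) :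
  \sum_(n in supp_in K [set: 'I_N]) F n = \sum_n F n.
Proof.
by apply: eq_bigl => n; apply/supp_inP => i; rewrite finset.in_setT.
Qed.

Definition tot_on I K (n : times K) : nat := \sum_(i in I) n i.

Lemma tot_on_setC I K (n : times K) : (tot_on I n + tot_on (~: I) n = tot n)%N.
Proof.
rewrite /tot (bigID (mem I)) /=; congr (_ + _)%N; apply: eq_bigl => i.
by rewrite finset.in_setC.
Qed.

Lemma split_supp K I (f g : nat -> R) : (forall s, 0 <= f s) -> (forall s, 0 <= g s) ->
  \sum_(n : times K) f (tot_on I n) * g (tot_on (~: I) n) <=
  (\sum_(n in supp_in K I) f (tot n)) * (\sum_(n in supp_in K (~: I)) g (tot n)).
Proof.
move=> f0 g0; rewrite big_distrlr /= pair_big_dep /=.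
pose cut (I' : {set 'I_N}) (n : times K) : times K := [ffun i => if i \in I' then n i else ord0].
have cutT I' n : tot (cut I' n) = tot_on I' n.
  rewrite /tot /tot_on [RHS]big_mkcond; apply: eq_bigr => i _.
  by rewrite ffunE; case: ifP.
have cutS I' n : cut I' n \in supp_in K I'.
  by apply/supp_inP => i iI; rewrite ffunE (negPf iI).
under eq_bigr => n _ do rewrite -!cutT.
apply: (ler_sum_inj (A := predT) (h := fun n => (cut I n, cut (~: I) n))
  (F := fun p : times K * times K => f (tot p.1) * g (tot p.2))).
- move=> n n' _ _ [/ffunP E1 /ffunP E2]; apply/ffunP => i.
  have := E1 i; have := E2 i; rewrite !ffunE finset.in_setC.
  by case: (i \in I).
- by move=> n _; rewrite unfold_in /= !cutS.
- by move=> p; rewrite mulr_ge0.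
Qed.

Definition Cball : R := 3 * (3 ^+ d * Cdiag R d).

Lemma Cball_ge0 : 0 <= Cball.
Proof.
by have := @Cdiag_ge1 R d d_gt0; rewrite /Cball => h; rewrite !mulr_ge0 ?exprn_ge0 //; lra.
Qed.

(** The first summand pays for the region near the origin in [pair_green_fixed], the second for the
    region away from it. *)
Definition Cpair (q : nat) : R := Cball * Cg ^+ 2 * q%:R ^+ d + Cg ^+ 2.

Lemma Cpair_ge0 q : 0 <= Cpair q.
Proof.
rewrite /Cpair addr_ge0 ?exprn_ge0 ?Cg_ge0 //.
by rewrite (mulr_ge0 (mulr_ge0 Cball_ge0 (exprn_ge0 2 Cg_ge0))) ?exprn_ge0.
Qed.

(* Near the origin the two last factors are bounded pointwise; away from it the
   first factor is, and the convolution of the other two is a Green function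
   at [a - b]. *)
Lemma pair_green_fixed q K I (r : nat) a b : (0 < r)%N ->
  (2 * r <= (nrm a).+2)%N -> (2 * r <= (nrm b).+2)%N ->
  ((nrm (a - b)).+1 <= q * r)%N ->
  \sum_(l : times K) \sum_(j : times K)
    steps (tot l) (fun u => heat (tot_on I j) (a - u) * heat (tot_on (~: I) j) (b - u)) 0
  <= Cpair q * (decay N r * decay N (nrm (a - b)).+1).
Proof.
move=> r0 ra rb abq; set w := (nrm (a - b)).+1 in abq *.
pose f (j : times K) u := heat (tot_on I j) (a - u) * heat (tot_on (~: I) j) (b - u).
change (\sum_(l : times K) \sum_(j : times K) steps (tot l) (f j) 0 <=
  Cpair q * (decay N r * decay N w)).
have f0 j u : 0 <= f j u by rewrite mulr_ge0 ?heat_ge0.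
have kN : (#|I| + #|~: I| = N)%N by rewrite cardsC card_ord.
pose G u := \sum_(l : times K) heat (tot l) u.
have G0 u : 0 <= G u by rewrite sumr_ge0 // => l _; apply: heat_ge0.
have Gdecay u s : (0 < s)%N -> (s <= (nrm u).+1)%N -> G u <= Cg * decay N s.
  move=> s0 su; rewrite /G -sum_supp_setT.
  by have := @green_decay K [set: 'I_N] u s s0 su; rewrite cardsT card_ord.
have [M MN] : exists M, M = (N * K)%N by eexists.
have lM (l : times K) : (tot l <= M)%N.
  rewrite MN /tot -[N in leqRHS]card_ord -sum_nat_const leq_sum // => i _.
  by rewrite -ltnS.
have -> : \sum_(l : times K) \sum_j steps (tot l) (f j) 0 =
    \sum_(u <- box d M) G u * \sum_j f j u.
  under eq_bigr => l _ do under eq_bigr => j _ do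
    rewrite -(@sum_heat R d (tot l) M 0) ?nrm0 // ?lM //.
  under eq_bigr => l _ do rewrite exchange_big.
  rewrite exchange_big /=; apply: eq_bigr => u _.
  rewrite /G mulr_suml; apply: eq_bigr => l _.
  by rewrite subr0 -mulr_sumr.
rewrite (bigID (fun u => nrm u < r)%N) /= [leRHS]mulrDl lerD //.
  apply: le_trans (_ : \sum_(u <- box d M | (nrm u < r)%N) G u * (Cg ^+ 2 * (decay #|I| r * decay #|~: I| r)) <= _).
    rewrite ler_sum // => u ur; rewrite ler_wpM2l //.
    apply: le_trans (split_supp K I (f := fun s => heat s (a - u))
      (g := fun s => heat s (b - u)) _ _) _ => [s|s|]; try exact: heat_ge0.
    rewrite expr2 mulrACA; apply: ler_pM; try (by rewrite sumr_ge0 // => n _; apply: heat_ge0).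
      (* Here [nrm u <= r - 1] and [2 * r - 2 <= nrm a] leave [r - 1 <= nrm (a - u)]; this is the
         origin of the [.+2] in the hypotheses. *)
      by apply: green_decay => //; have := nrmD (a - u) u; rewrite subrK; lia.
    by apply: green_decay => //; have := nrmD (b - u) u; rewrite subrK; lia.
  rewrite -mulr_suml.
  have near : \sum_(u <- box d M | (nrm u < r)%N) G u <= Cball * r%:R ^+ (2 * N).
    apply: le_trans (_ : \sum_(u <- box d r) G u <= _); last first.
      under eq_bigr => u _ do rewrite /G -sum_supp_setT.
      have := @green_ball R d N d_gt0 K [set: 'I_N] r; rewrite cardsT card_ord; exact.
    rewrite -big_filter [leRHS](bigID (fun u => (nrm u < r)%N && (u \in box d M))) /=.
    rewrite -[leLHS]addr0 lerD ?sumr_ge0 // -[leRHS]big_filter.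
    rewrite le_eqVlt; apply/orP; left; apply/eqP/perm_big/uniq_perm;
      rewrite ?filter_uniq ?box_uniq // => u; rewrite !mem_filter.
    case: (ltnP (nrm u) r) => //= ur.
    by rewrite (mem_box (ltnW ur)) andbT.
  apply: le_trans (_ : Cball * r%:R ^+ (2 * N) * (Cg ^+ 2 * (decay #|I| r * decay #|~: I| r)) <= _).
    by rewrite ler_wpM2r // mulr_ge0 ?exprn_ge0 ?Cg_ge0 // mulr_ge0 ?decay_ge0.
  have rd : r%:R ^+ d != 0 :> R by rewrite expf_neq0 // pnatr_eq0 -lt0n.
  (* The [r^(2N)] visits near the origin restore a second factor [decay N r] from the two partial
     decays, because the cardinals of [I] and its complement add up to [N]. *)
  have -> : Cball * r%:R ^+ (2 * N) * (Cg ^+ 2 * (decay #|I| r * decay #|~: I| r)) =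
      Cball * Cg ^+ 2 * (decay N r * decay N r).
    have E : r%:R ^+ (2 * N) = r%:R ^+ (2 * #|I|) * r%:R ^+ (2 * #|~: I|) :> R.
      by rewrite -exprD -mulnDr kN.
    by rewrite /decay E; field.
  rewrite -[leRHS]mulrA ler_wpM2l ?(mulr_ge0 Cball_ge0 (exprn_ge0 2 Cg_ge0)) //.
  by rewrite [leRHS]mulrCA ler_wpM2l ?decay_ge0 // decay_scale // ltnW.
apply: le_trans (_ : \sum_(u <- box d M | ~~ (nrm u < r)%N) Cg * decay N r * \sum_j f j u <= _).
  rewrite ler_sum // => u; rewrite -leqNgt => ur; rewrite ler_wpM2r ?sumr_ge0 //.
  by apply: Gdecay => //; lia.
rewrite -mulr_sumr expr2 -mulrA mulrCA -mulrA.
rewrite [leRHS](_ : _ = Cg * (decay N r * (Cg * decay N w))); last by ring.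
rewrite [leLHS](_ : _ = Cg * (decay N r * \sum_(u <- box d M | ~~ (nrm u < r)%N) \sum_j f j u)); last by ring.
rewrite !ler_wpM2l ?Cg_ge0 ?decay_ge0 //.
apply: le_trans (Gdecay (a - b) w isT (leqnn _)).
apply: le_trans (_ : \sum_(u <- box d M) \sum_j f j u <= _).
  rewrite [leRHS](bigID (fun u => nrm u < r)%N) /= lerDr sumr_ge0 // => u _.
  by rewrite sumr_ge0.
rewrite exchange_big ler_sum //= => j _.
rewrite -(tot_on_setC I j).
apply: le_trans (_ : steps (tot_on I j) (fun u => heat (tot_on (~: I) j) (u - b)) a <= _); last first.
  by rewrite steps_heat.
apply: le_trans (sum_heat_le (tot_on I j) M a _); last by move=> u; apply: heat_ge0.
by rewrite ler_sum // => u _; rewrite /f heatBC (heatBC _ b).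
Qed.

(* [I] is the set of indices [i] with [m i <= n i]; (I, min(n,m), |n-m|) determines
   (n, m). *)
Lemma pair_green q K (r : nat) a b : (0 < r)%N ->
  (2 * r <= (nrm a).+2)%N -> (2 * r <= (nrm b).+2)%N ->
  ((nrm (a - b)).+1 <= q * r)%N ->
  \sum_(n : times K) \sum_(m : times K)
    steps (\sum_i minn (n i) (m i)) (fun u => heat (\sum_i (n i - m i)) (a - u) *
       heat (\sum_i (m i - n i)) (b - u)) 0
  <= 2 ^+ N * Cpair q * (decay N r * decay N (nrm (a - b)).+1).
Proof.
move=> r0 ra rb abq.
pose Psi (t : {set 'I_N} * (times K * times K)) := steps (tot t.2.1)
  (fun u => heat (tot_on t.1 t.2.2) (a - u) * heat (tot_on (~: t.1) t.2.2) (b - u)) 0.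
have Psi0 t : 0 <= Psi t by apply: steps_ge0 => u; rewrite mulr_ge0 ?heat_ge0.
pose dom (n m : times K) : {set 'I_N} := [set i | (m i <= n i)%N]%SET.
pose lo (n m : times K) : times K := [ffun i => if (m i <= n i)%N then m i else n i].
pose df (n m : times K) : times K :=
  [ffun i => inord (if (m i <= n i)%N then n i - m i else m i - n i)%N].
have dfE n m i : df n m i = (if (m i <= n i)%N then n i - m i else m i - n i)%N :> nat.
  rewrite ffunE inordK //; have := ltn_ord (m i); have := ltn_ord (n i).
  by case: ifP; lia.
have loE n m i : lo n m i = (if (m i <= n i)%N then m i else n i) :> nat.
  by rewrite ffunE; case: ifP.
have inD n m i : (i \in dom n m) = (m i <= n i)%N by rewrite inE.
rewrite pair_big /=.
rewrite (eq_bigr (fun p => Psi (dom p.1 p.2, (lo p.1 p.2, df p.1 p.2)))); last first.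
  move=> [n m] _ /=; rewrite /Psi /=.
  have -> : tot (lo n m) = (\sum_i minn (n i) (m i))%N.
    by apply: eq_bigr => i _; rewrite loE; case: leqP; lia.
  have -> : tot_on (dom n m) (df n m) = (\sum_i (n i - m i))%N.
    rewrite /tot_on big_mkcond; apply: eq_bigr => i _.
    by rewrite inD dfE; case: leqP => //; lia.
  have -> // : tot_on (~: dom n m) (df n m) = (\sum_i (m i - n i))%N.
  rewrite /tot_on big_mkcond; apply: eq_bigr => i _.
  by rewrite finset.in_setC inD dfE; case: leqP => //=; lia.
apply: le_trans (_ : \sum_t Psi t <= _).
  apply: (ler_sum_inj (A := predT) (B := predT) (F := Psi)
     (h := fun p : times K * times K => (dom p.1 p.2, (lo p.1 p.2, df p.1 p.2)))) => //.
  move=> [n m] [n' m'] _ _ [] /= /setP E1 /ffunP E2 /ffunP E3.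
  have E i : n i = n' i /\ m i = m' i.
    have := congr1 (@nat_of_ord _) (E3 i); have := congr1 (@nat_of_ord _) (E2 i); have := E1 i.
    rewrite !inD /= !dfE !loE => e1; rewrite e1; move: e1.
    move: (n i) (m i) (n' i) (m' i) => [x Hx] [y Hy] [x' Hx'] [y' Hy'] /=.
    case: (leqP y' x') => h1; case: (leqP y x) => h2 // _ /= h3 h4; split; apply: val_inj => /=; lia.
  by congr pair; apply/ffunP => i; case: (E i).
rewrite -(pair_big xpredT xpredT (fun I p => Psi (I, p))) /=.
have -> : 2 ^+ N * Cpair q * (decay N r * decay N (nrm (a - b)).+1) =
   \sum_(I : {set 'I_N}) Cpair q * (decay N r * decay N (nrm (a - b)).+1).
  rewrite sumr_const -mulrA -[RHS]mulr_natl; congr (_ * _).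
  by rewrite -cardsT -powersetT card_powerset cardsT card_ord natrX.
apply: ler_sum => I _; apply: le_trans (pair_green_fixed K I r0 ra rb abq).
by rewrite pair_big.
Qed.

End PairSum.

(** * Finite model of the increments *)

Section FiniteModel.
Context {R : realType} {d : nat} {J : finType}.
Hypothesis d_gt0 : (0 < d)%N.
Local Notation Om := {ffun J -> dir d}.
Implicit Types (w v : Om) (B : {set J}) (f g : Om -> R).

Definition mean f : R := #|{: Om}|%:R^-1 * \sum_w f w.

Definition walk B w : Zd d := \sum_(j in B) vec (w j).

Definition splice B w v : Om := [ffun j => if j \in B then v j else w j].

(** Measurability with respect to the coordinates outside [B]. *)
Definition free_of {T : Type} B (f : Om -> T) :=
  forall w v, f (splice B w v) = f w.

Definition upd w j e : Om := [ffun k => if k == j then e else w k].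

Lemma card_Om_neq0 : #|{: Om}|%:R != 0 :> R.
Proof.
rewrite pnatr_eq0 card_ffun expn_eq0 negb_and card_dir.
by apply/orP; left; lia.
Qed.

Lemma eq_mean f g : f =1 g -> mean f = mean g.
Proof. by move=> fg; congr (_ * _); apply: eq_bigr => w _. Qed.

Lemma mean_le f g : (forall w, f w <= g w) -> mean f <= mean g.
Proof. by move=> fg; rewrite ler_wpM2l ?invr_ge0 // ler_sum. Qed.

Lemma mean_add f g : mean (fun w => f w + g w) = mean f + mean g.
Proof. by rewrite /mean big_split mulrDr. Qed.

Lemma mean_scale c f : mean (fun w => c * f w) = c * mean f.
Proof. by rewrite /mean -mulr_sumr mulrCA. Qed.

Lemma mean_scaler c f : mean (fun w => f w * c) = mean f * c.
Proof. by rewrite mulrC -mean_scale; apply: eq_mean => w; rewrite mulrC. Qed.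

Lemma mean_sum (I : Type) (r : seq I) (Q : pred I) (F : I -> Om -> R) :
  mean (fun w => \sum_(i <- r | Q i) F i w) = \sum_(i <- r | Q i) mean (F i).
Proof. by rewrite /mean exchange_big mulr_sumr. Qed.

Lemma mean_sum_mul (I I' : finType) (F : I -> Om -> R) (G : I' -> Om -> R) :
  mean (fun w => (\sum_i F i w) * (\sum_j G j w)) =
  \sum_i \sum_j mean (fun w => F i w * G j w).
Proof.
transitivity (mean (fun w => \sum_i \sum_j F i w * G j w)).
  by apply: eq_mean => w; rewrite big_distrlr.
by rewrite mean_sum; apply: eq_bigr => i _; rewrite mean_sum.
Qed.

Lemma mean_cst c : mean (fun=> c) = c.
Proof. by rewrite /mean sumr_const -(mulr_natl c) mulKf ?card_Om_neq0. Qed.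

Lemma mean_ge0 f : (forall w, 0 <= f w) -> 0 <= mean f.
Proof. by move=> f0; rewrite mulr_ge0 ?invr_ge0 ?sumr_ge0. Qed.

Lemma mean_mean_swap (F : Om -> Om -> R) (h : Om * Om -> Om * Om) : involutive h ->
  mean (fun w => mean (F w)) =
  mean (fun w => mean (fun v => F (h (w, v)).1 (h (w, v)).2)).
Proof.
move=> hK; rewrite /mean; congr (_ * _); rewrite -!mulr_sumr; congr (_ * _).
rewrite !pair_big (reindex_inj (inv_inj hK)) /=.
by apply: eq_bigr => -[w v].
Qed.

(** Exchanging the [B]-coordinates of two independent samples preserves the product measure;
    self-adjointness and the tower property of [avg] rest on this. *)
Lemma splice_swap B :
  involutive (fun p : Om * Om => (splice B p.1 p.2, splice B p.2 p.1)).
Proof.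
by case=> w v /=; congr pair; apply/ffunP => j; rewrite !ffunE; case: (j \in B).
Qed.

Lemma mean_splice B g : mean (fun w => mean (fun v => g (splice B w v))) = mean g.
Proof.
rewrite (mean_mean_swap (fun w v => g (splice B w v)) (splice_swap B)) /=.
apply: eq_mean => w; rewrite -[RHS](mean_cst (g w)); apply: eq_mean => v.
by congr g; apply/ffunP => j; rewrite !ffunE; case: (j \in B).
Qed.

(** The conditional expectation given the coordinates outside [B], obtained by resampling those in
    [B]. *)
Definition avg B f w : R := mean (fun v => f (splice B w v)).

Lemma avg_adj B f g :
  mean (fun w => avg B f w * g w) = mean (fun w => f w * avg B g w).
Proof.
transitivity (mean (fun w => mean (fun v => f (splice B w v) * g w))).
  by apply: eq_mean => w; rewrite mean_scaler.
rewrite (mean_mean_swap (fun w v => f (splice B w v) * g w) (splice_swap B)) /=.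
apply: eq_mean => w; rewrite -mean_scale; apply: eq_mean => v.
by congr (f _ * _); apply/ffunP => j; rewrite !ffunE; case: (j \in B).
Qed.

Lemma splice_comp B B' w v u :
  splice B' (splice B w v) u = splice (B :|: B') w (splice B' v u).
Proof.
apply/ffunP => j; rewrite !ffunE finset.in_setU.
by case: (j \in B); case: (j \in B').
Qed.

Lemma avg_comp B B' f w : avg B (avg B' f) w = avg (B :|: B') f w.
Proof.
rewrite /avg -(mean_splice B' (fun v => f (splice (B :|: B') w v))).
by apply: eq_mean => v; apply: eq_mean => u; rewrite splice_comp.
Qed.

Lemma avg_free B f : free_of B (avg B f).
Proof.
move=> w v; apply: eq_mean => u; congr f.
by apply/ffunP => j; rewrite !ffunE; case: (j \in B).
Qed.

Lemma free_avg B f w : free_of B f -> avg B f w = f w.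
Proof. by move=> fB; rewrite -[RHS]mean_cst; apply: eq_mean => v. Qed.

Lemma avg_ge0 B f w : (forall v, 0 <= f v) -> 0 <= avg B f w.
Proof. by move=> f0; apply: mean_ge0. Qed.

Lemma avg0 f w : avg finset.set0 f w = f w.
Proof.
by apply: free_avg => u v; congr f; apply/ffunP => j; rewrite ffunE finset.in_set0.
Qed.

Lemma avg_sum (I : Type) (r : seq I) (Q : pred I) (F : I -> Om -> R) B w :
  avg B (fun v => \sum_(i <- r | Q i) F i v) w = \sum_(i <- r | Q i) avg B (F i) w.
Proof. by rewrite /avg mean_sum. Qed.

Lemma cauchy_schwarz f g :
  mean (fun w => f w * g w) ^+ 2 <= mean (fun w => f w ^+ 2) * mean (fun w => g w ^+ 2).
Proof.
set a := mean (fun w => f w ^+ 2); set b := mean (fun w => g w ^+ 2).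
set c := mean (fun w => f w * g w).
have a0 : 0 <= a by apply: mean_ge0 => w; rewrite sqr_ge0.
have q (s t : R) : 0 <= s ^+ 2 * a - 2 * s * t * c + t ^+ 2 * b.
  have -> : s ^+ 2 * a - 2 * s * t * c + t ^+ 2 * b = mean (fun w => (s * f w - t * g w) ^+ 2).
    rewrite /a /b /c -mulNr -!mean_scale -!mean_add; apply: eq_mean => w; ring.
  by apply: mean_ge0 => w; rewrite sqr_ge0.
have [a00|a1] := eqVneq a 0.
  rewrite a00 mul0r; have := q (b + 1) c; have := q (- (b + 1)) c.
  have b0 : 0 <= b by apply: mean_ge0 => w; rewrite sqr_ge0.
  rewrite a00 => _ h; have : c ^+ 2 * (b + 2) <= 0 by nra.
  by rewrite pmulr_lle0 //; lra.
have ap : 0 < a by rewrite lt_def a1.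
have h := q c a; rewrite -(ler_pM2l ap).
rewrite -subr_ge0; have -> : a * (a * b) - a * c ^+ 2 = c ^+ 2 * a - 2 * c * a * c + a ^+ 2 * b by ring.
by [].
Qed.

(* Dual form of Doob's L^2 inequality, [avg (B k)] being conditional expectations. *)
Lemma dual_doob M (B : 'I_M -> {set J}) (f : 'I_M -> Om -> R) :
  (forall k l : 'I_M, (k <= l)%N -> B l \subset B k) ->
  (forall k w, 0 <= f k w) ->
  mean (fun w => (\sum_k avg (B k) (f k) w) ^+ 2) <=
  4 * mean (fun w => (\sum_k f k w) ^+ 2).
Proof.
move=> Bmono f0; pose F w := \sum_k avg (B k) (f k) w; pose s w := \sum_k f k w.
have le (k l : 'I_M) : (k <= l)%N -> mean (fun w => avg (B k) (f k) w * avg (B l) (f l) w) =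
    mean (fun w => avg (B k) (f k) w * f l w).
  move=> kl; rewrite -avg_adj; apply: eq_mean => w; rewrite avg_comp.
  by rewrite (finset.setUidPr (Bmono k l kl)).
have ag k w : 0 <= avg (B k) (f k) w by apply: avg_ge0.
have h : mean (fun w => F w ^+ 2) <= 2 * mean (fun w => F w * s w).
  have -> : mean (fun w => F w * s w) = \sum_k \sum_l mean (fun w => avg (B k) (f k) w * f l w).
    exact: mean_sum_mul.
  have -> : mean (fun w => F w ^+ 2) = \sum_k \sum_l mean (fun w => avg (B k) (f k) w * avg (B l) (f l) w).
    exact: mean_sum_mul.
  (* Each pair is charged to its smaller index, whose average absorbs the other one; the second,
     nonnegative summand is discarded. *)
  apply: le_trans (_ : \sum_k \sum_l (mean (fun w => avg (B k) (f k) w * f l w)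
     + mean (fun w => avg (B l) (f l) w * f k w)) <= _).
    apply: ler_sum => k _; apply: ler_sum => l _.
    have [kl|/ltnW lk] := leqP k l.
      by rewrite le // lerDl mean_ge0 // => w; rewrite mulr_ge0.
    rewrite (eq_mean (g := fun w => avg (B l) (f l) w * avg (B k) (f k) w)) => [|w]; last exact: mulrC.
    by rewrite le // lerDr mean_ge0 // => w; rewrite mulr_ge0.
  under eq_bigr do rewrite big_split.
  by rewrite big_split /= [X in _ + X]exchange_big mulr_natl.
(* Expanding this square bounds the mean of [F * s] by those of [F ^+ 2] and [s ^+ 2]; inserted in
   [h] it gives the factor [4]. *)
have : 0 <= mean (fun w => (F w - 2 * s w) ^+ 2) by apply: mean_ge0 => w; rewrite sqr_ge0.
have -> : mean (fun w => (F w - 2 * s w) ^+ 2) =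
   mean (fun w => F w ^+ 2) + (-4) * mean (fun w => F w * s w) + 4 * mean (fun w => s w ^+ 2).
  by rewrite -!mean_scale -!mean_add; apply: eq_mean => w; ring.
move: h; rewrite /F /s; lra.
Qed.

Lemma updE B w j e : j \in B -> upd w j e = splice B w (upd w j e).
Proof.
move=> jB; apply/ffunP => k; rewrite !ffunE; case: (boolP (k \in B)) => // kB.
by move: kB; case: (eqVneq k j) => [->|]; rewrite ?jB.
Qed.

Lemma mean_upd j f :
  mean f = mean (fun w => (2 * d)%:R^-1 * \sum_e f (upd w j e)).
Proof.
rewrite /mean; congr (_ * _); rewrite -mulr_sumr.
have -> : \sum_w \sum_e f (upd w j e) = \sum_w \sum_(e : dir d) f w.
  rewrite !pair_big (reindex_inj (inv_inj (_ : involutive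
    (fun p : Om * dir d => (upd p.1 j p.2, p.1 j))))) /=.
    apply: eq_bigr => -[w e] _ /=; congr f; apply/ffunP => k.
    by rewrite !ffunE; have [->|] := eqVneq k j; rewrite ?eqxx.
  move=> [w e] /=; congr pair; last by rewrite ffunE eqxx.
  by apply/ffunP => k; rewrite !ffunE; have [->|] := eqVneq k j.
rewrite [X in _ * X](_ : _ = (2 * d)%:R * \sum_w f w); last first.
  by rewrite mulr_sumr; apply: eq_bigr => w _; rewrite sumr_const card_dir mulr_natl.
by rewrite mulKf // pnatr_eq0; lia.
Qed.

(** The increments in [B] are integrated out one at a time; as [H] does not depend on them, only
    their number survives. *)
Lemma mean_walk B (H : Om -> Zd d -> R) : (forall x, free_of B (H^~ x)) ->
  mean (fun w => H w (walk B w)) = mean (fun w => steps #|B| (H w) 0).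
Proof.
move: {2}#|B| (erefl #|B|) => n; elim: n B H => [|n IH] B H Bn HB.
  apply: eq_mean => w; rewrite Bn /walk big_pred0 // => j.
  by move: Bn => /eqP; rewrite cards_eq0 => /eqP ->; rewrite finset.in_set0.
have /card_gt0P[j jB] : (0 < #|B|)%N by rewrite Bn.
have Bj : #|B :\ j| = n by have := cardsD1 j B; rewrite jB Bn => -[].
rewrite Bn (mean_upd j).
transitivity (mean (fun w => step (H w) (walk (B :\ j) w))).
  apply: eq_mean => w; congr (_ * _); apply: eq_bigr => e _.
  have -> : walk B (upd w j e) = walk (B :\ j) w + vec e.
    rewrite /walk (big_setD1 j) //= ffunE eqxx addrC; congr (_ + _).
    apply: eq_bigr => k; rewrite !inE => /andP[/negPf kj _].
    by rewrite ffunE kj.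
  by rewrite (updE w e jB); apply: HB.
rewrite (IH (B :\ j) (fun w => step (H w))) //; last first.
  move=> x w v /=; apply: eq_step => y.
  have -> : splice (B :\ j) w v = splice B w (splice (B :\ j) w v).
    apply/ffunP => k; rewrite !ffunE !inE.
    by case: (k \in B); rewrite ?andbT ?andbF.
  exact: HB.
by apply: eq_mean => w; rewrite Bj stepsSr.
Qed.

Lemma walk_free B B' : {in B, forall j, j \notin B'} -> free_of B' (walk B).
Proof.
move=> dis w v; apply: eq_bigr => j jB; rewrite ffunE.
by rewrite (negPf (dis j jB)).
Qed.

Lemma walkID B B' w : walk B w = walk (B :&: B') w + walk (B :\: B') w.
Proof. by rewrite /walk (finset.big_setID B'). Qed.

Lemma steps_dirac0 n a : steps n (fun x => dirac0 (x - a)) 0 = @heat R d n a.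
Proof. by rewrite (steps_shift n dirac0 (- a)) add0r -[RHS]heatN. Qed.

(** The two walks share the increments in [B :&: B'], which lead to [u]. The two differences are
    disjoint and are integrated out first, each giving a heat kernel from [u]. *)
Lemma mean_walk2 B B' (a b : Zd d) :
  mean (fun w => dirac0 (walk B w - a) * dirac0 (walk B' w - b)) =
  steps #|B :&: B'| (fun u => heat #|B :\: B'| (a - u) * heat #|B' :\: B| (b - u)) 0.
Proof.
pose C := B :&: B'; pose D := B :\: B'; pose D' := B' :\: B.
have dCD : {in C, forall j, j \notin D}.
  by move=> j; rewrite !inE; case: (j \in B); case: (j \in B').
have dCD' : {in C, forall j, j \notin D'}.
  by move=> j; rewrite !inE; case: (j \in B); case: (j \in B').
have dD'D : {in D', forall j, j \notin D}.
  by move=> j; rewrite !inE; case: (j \in B); case: (j \in B').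
pose H1 w x : R := dirac0 (walk C w + x - a) * dirac0 (walk C w + walk D' w - b).
pose H2 w x : R := heat #|D| (a - walk C w) * dirac0 (walk C w + x - b).
pose H3 (w : Om) u : R := heat #|D| (a - u) * heat #|D'| (b - u).
transitivity (mean (fun w => H1 w (walk D w))).
  apply: eq_mean => w; rewrite (walkID B B') (walkID B' B).
  by rewrite (finset.setIC B' B).
rewrite (mean_walk (H := H1)) => [|x w v]; last first.
  by rewrite /H1 !(walk_free dCD) (walk_free dD'D).
transitivity (mean (fun w => H2 w (walk D' w))).
  apply: eq_mean => w; rewrite /H2 -(steps_dirac0 #|D|) [RHS]mulrC -steps_scale.
  apply: eq_steps => y.
  by rewrite /H1 mulrC opprB addrA [walk C w + y]addrC.
rewrite (mean_walk (H := H2)) => [|x w v]; last by rewrite /H2 !(walk_free dCD').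
transitivity (mean (fun w => H3 w (walk C w))).
  apply: eq_mean => w; rewrite /H2 steps_scale; congr (_ * _).
  rewrite -(steps_dirac0 #|D'|); apply: eq_steps => y.
  by rewrite opprB addrA [walk C w + y]addrC.
by rewrite (mean_walk (H := H3)) => [|x w v] //;
  exact: (mean_cst (steps #|C| (fun u => heat #|D| (a - u) * heat #|D'| (b - u)) 0)).
Qed.

End FiniteModel.

(** * Occupation and hitting in the finite model *)

Section HitModel.
Context {R : realType} {d N L : nat}.
Hypothesis d_gt0 : (0 < d)%N.
Hypothesis N_gt0 : (0 < N)%N.
Hypothesis Nd : (2 * N < d)%N.
Local Notation J := ('I_N * 'I_L)%type.
Local Notation Om := {ffun J -> dir d}.
Local Notation times K := {ffun 'I_N -> 'I_K.+1}.
Local Notation heat := (@heat R d).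
Local Notation mean := (@mean R d J).
Local Notation decay := (@decay R d).
Implicit Types (w v : Om) (x y z : Zd d).

Definition past K (n : times K) : {set J} := [set j : J | (j.2 < n j.1)%N]%SET.

(** For [r = N] this is the complement of [past n]; smaller [r] are the stages at which only the
    first [r] clocks have been conditioned. *)
Definition future_upto (r : nat) K (n : times K) : {set J} :=
  [set j : J | (j.1 < r)%N && (n j.1 <= j.2)%N]%SET.

Lemma card_slab (p q : 'I_N -> nat) : (forall i, q i <= L)%N ->
  #|[set j : J | (p j.1 <= j.2 < q j.1)%N]%SET| = (\sum_i (q i - p i))%N.
Proof.
move=> qL; rewrite -sum1_card.
rewrite (eq_bigl (fun j : J => xpredT j.1 && (p j.1 <= j.2 < q j.1)%N)); last by move=> j; rewrite inE.
rewrite -(pair_big_dep xpredT (fun i (k : 'I_L) => (p i <= k < q i)%N) (fun _ _ => 1%N)) /=.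
apply: eq_bigr => i _; rewrite -(big_mkord (fun k => p i <= k < q i)%N (fun=> 1%N)).
have [pq|qp] := leqP (p i) (q i); last first.
  by rewrite big_pred0 => [|k]; [|apply/negbTE]; lia.
rewrite (big_cat_nat (n := p i)) ?(leq_trans pq (qL i)) //=.
rewrite big_nat_cond big_pred0 => [|k]; last by apply/negbTE; lia.
rewrite add0n (big_cat_nat (n := q i)) ?(qL i) //= [X in (_ + X)%N]big_nat_cond.
rewrite [X in (_ + X)%N]big_pred0 => [|k]; last by apply/negbTE; lia.
rewrite addn0 big_nat_cond (eq_bigl (fun k => (p i <= k < q i)%N && true)) => [|k].
  by rewrite -big_nat_cond sum_nat_const_nat muln1.
by rewrite andbT andbb.
Qed.

(** Induction on the number of conditioned clocks: grouping the time vectors by the value of the new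
    clock gives a decreasing family of sets of future increments of that walk, to which [dual_doob]
    applies. *)
Lemma doob_times K (a : times K -> Om -> R) r : (r <= N)%N ->
  (forall n w, 0 <= a n w) ->
  mean (fun w => (\sum_n avg (future_upto r n) (a n) w) ^+ 2) <=
  4 ^+ r * mean (fun w => (\sum_n a n w) ^+ 2).
Proof.
move=> rN a0; elim: r rN => [|r IH] rN.
  rewrite expr0 mul1r le_eqVlt; apply/orP; left; apply/eqP.
  apply: eq_mean => w; congr (_ ^+ 2); apply: eq_bigr => n _.
  have -> : future_upto 0 n = finset.set0 by apply/setP => j; rewrite !inE.
  exact: avg0.
apply: le_trans (_ : 4 * mean (fun w => (\sum_n avg (future_upto r n) (a n) w) ^+ 2) <= _); last first.
  by rewrite exprS -mulrA ler_wpM2l // IH // ltnW.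
pose i := Ordinal rN.
pose B (k : 'I_K.+1) : {set J} := [set j : J | (j.1 == i) && (k <= j.2)%N]%SET.
pose f (k : 'I_K.+1) w := \sum_(n : times K | n i == k) avg (future_upto r n) (a n) w.
have fE w : \sum_n avg (future_upto r n) (a n) w = \sum_k f k w.
  by rewrite (partition_big (fun n : times K => n i) xpredT).
have FE w : \sum_n avg (future_upto r.+1 n) (a n) w = \sum_k avg (B k) (f k) w.
  rewrite (partition_big (fun n : times K => n i) xpredT) //=.
  apply: eq_bigr => k _; rewrite avg_sum; apply: eq_bigr => n /eqP nk.
  rewrite avg_comp // (_ : B k :|: future_upto r n = future_upto r.+1 n)%SET //.
  apply/setP => j; rewrite !inE -nk ltnS [in RHS]leq_eqVlt -(inj_eq val_inj) /=.
  have [ji|//] := eqVneq (val j.1) r.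
  have -> : j.1 = i by apply: val_inj.
  by rewrite /= ltnn orbF.
rewrite (eq_mean (fun w => congr1 (fun t => t ^+ 2) (FE w))).
rewrite (eq_mean (fun w => congr1 (fun t => t ^+ 2) (fE w))).
apply: dual_doob => // [k l kl|k w].
  by apply/fintype.subsetP => j; rewrite !inE => /andP[-> lj]; rewrite (leq_trans kl).
by rewrite sumr_ge0 // => n _; apply: (avg_ge0 _ _ (a0 n)).
Qed.

(* Number of visits to [A] of the additive walk started at [z], weighted by [nu]. *)
Definition occ K (A : {fset Zd d}) (nu : Zd d -> R) z w : R :=
  \sum_(n : times K) \sum_(x <- A) nu x * dirac0 (walk (past n) w - (x - z)).

(** The energy for the kernel produced by [pair_green], in integer distances; it agrees with
    [energy] up to a power of [d]. *)
Definition denergy (A : {fset Zd d}) (nu : Zd d -> R) : R :=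
  \sum_(x <- A) \sum_(y <- A) decay N (nrm (x - y)).+1 * nu x * nu y.

Lemma card_past K (n : times K) : (K <= L)%N -> #|past n| = tot n.
Proof.
move=> KL; have -> : tot n = (\sum_i (n i - 0))%N by apply: eq_bigr => i _; rewrite subn0.
by rewrite -card_slab // => i; rewrite (leq_trans _ KL) // -ltnS.
Qed.

Lemma second_moment K (A : {fset Zd d}) nu z q r : (K <= L)%N -> (0 < r)%N ->
  (forall x, x \in A -> 0 <= nu x) ->
  (forall x, x \in A -> (2 * r <= (nrm (x - z)).+2)%N) ->
  (forall x y, x \in A -> y \in A -> ((nrm (x - y)).+1 <= q * r)%N) ->
  mean (fun w => occ K A nu z w ^+ 2) <=
  2 ^+ N * @Cpair R d q * decay N r * denergy A nu.
Proof.
move=> KL r0 nu0 zr xyr.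
have KLi (n : times K) i : (n i <= L)%N by rewrite (leq_trans _ KL) // -ltnS.
have pair x y : mean (fun w => (\sum_(n : times K) dirac0 (walk (past n) w - (x - z))) *
      (\sum_(m : times K) dirac0 (walk (past m) w - (y - z)))) =
    \sum_(n : times K) \sum_(m : times K)
    steps (\sum_i minn (n i) (m i)) (fun u => heat (\sum_i (n i - m i)) (x - z - u) *
       heat (\sum_i (m i - n i)) (y - z - u)) 0.
  rewrite mean_sum_mul; apply: eq_bigr => n _; apply: eq_bigr => m _.
  rewrite mean_walk2 //.
  have -> : #|past n :&: past m| = (\sum_i minn (n i) (m i))%N.
    transitivity (\sum_i (minn (n i) (m i) - 0))%N; last by apply: eq_bigr => i _; rewrite subn0.
    rewrite -card_slab => [|i]; last by rewrite geq_min KLi.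
    by apply: eq_card => j; rewrite !inE /= leq_min.
  have -> : #|past n :\: past m| = (\sum_i (n i - m i))%N.
    rewrite -card_slab => [|i]; last exact: KLi.
    by apply: eq_card => j; rewrite !inE /= -leqNgt.
  have -> // : #|past m :\: past n| = (\sum_i (m i - n i))%N.
  rewrite -card_slab => [|i]; last exact: KLi.
  by apply: eq_card => j; rewrite !inE /= -leqNgt.
have -> : mean (fun w => occ K A nu z w ^+ 2) = \sum_(x <- A) \sum_(y <- A) nu x * nu y *
   mean (fun w => (\sum_(n : times K) dirac0 (walk (past n) w - (x - z))) *
      (\sum_(m : times K) dirac0 (walk (past m) w - (y - z)))).
  transitivity (mean (fun w => \sum_(x <- A) \sum_(y <- A) nu x * nu y *
     ((\sum_(n : times K) dirac0 (walk (past n) w - (x - z))) *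
      (\sum_(m : times K) dirac0 (walk (past m) w - (y - z)))))).
    apply: eq_mean => w; rewrite /occ exchange_big expr2 big_distrlr /=.
    apply: eq_bigr => x _; apply: eq_bigr => y _.
    by rewrite -!mulr_sumr mulrACA.
  rewrite mean_sum; apply: eq_bigr => x _; rewrite mean_sum; apply: eq_bigr => y _.
  by rewrite mean_scale.
rewrite /denergy mulr_sumr !big_seq ler_sum // => x xA.
rewrite mulr_sumr !big_seq ler_sum // => y yA.
have -> : 2 ^+ N * @Cpair R d q * decay N r * (decay N (nrm (x - y)).+1 * nu x * nu y) =
  nu x * nu y * (2 ^+ N * @Cpair R d q * (decay N r * decay N (nrm (x - y)).+1)) by ring.
rewrite ler_wpM2l ?mulr_ge0 ?nu0 // pair.
have xy : x - y = (x - z) - (y - z) by rewrite opprB addrA subrK.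
by rewrite xy; apply: pair_green; rewrite ?zr // -xy xyr.
Qed.

Lemma mean_heat (f : Om -> R) (B : {set J}) K (n : times K) x z :
   free_of B f -> free_of B (walk (past n) : Om -> Zd d) ->
  mean (fun w => f w * dirac0 (walk (past n) w + walk B w - (x - z))) =
  mean (fun w => f w * heat #|B| (x - (z + walk (past n) w))).
Proof.
move=> fB wB.
pose H w u := f w * dirac0 (walk (past n) w + u - (x - z)).
rewrite (mean_walk d_gt0 (H := H)) => [|u w v]; last by rewrite /H fB wB.
apply: eq_mean => w; rewrite /H steps_scale -steps_dirac0; congr (_ * _).
apply: eq_steps => y; congr dirac0.
set p := walk _ w.
by rewrite !opprB !addrA [p + y]addrC [y + p + z]addrAC.
Qed.

Lemma mean_occ K (A : {fset Zd d}) nu z : (K <= L)%N ->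
  mean (occ K A nu z) = \sum_(x <- A) nu x * \sum_(n : times K) heat (tot n) (x - z).
Proof.
move=> KL; rewrite mean_sum.
under eq_bigr => n _ do rewrite mean_sum.
rewrite exchange_big; apply: eq_bigr => x _; rewrite mulr_sumr.
apply: eq_bigr => n _; rewrite mean_scale; congr (_ * _).
have := @mean_walk R d J d_gt0 (past n) (fun _ u => dirac0 (u - (x - z))).
move=> -> //; transitivity (mean (fun=> heat (tot n) (x - z))); last exact: mean_cst.
by apply: eq_mean => w; rewrite steps_dirac0 card_past.
Qed.

Definition hits K (A : {fset Zd d}) z w : bool :=
  [exists n : times K, z + walk (past n) w \in A].

Lemma occ_hits K A nu z w : occ K A nu z w * (hits K A z w)%:R = occ K A nu z w.
Proof.
case: (boolP (hits K A z w)) => h; rewrite ?mulr1 // mulr0 /occ.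
rewrite big1 // => n _; rewrite big_seq big1 // => x xA.
rewrite /dirac0 subr_eq0; case: eqP => [E|_]; last by rewrite mulr0.
by case/existsP: h; exists n; rewrite E addrC subrK.
Qed.

Lemma mean_bool (b : Om -> bool) : mean (fun w => (b w)%:R ^+ 2) = mean (fun w => (b w)%:R).
Proof. by apply: eq_mean => w; case: (b w); rewrite ?expr1n ?expr0n. Qed.

Lemma hit_lower K (A : {fset Zd d}) nu z q r m : (K <= L)%N -> (0 < r)%N ->
  probability_on A nu ->
  (forall x, x \in A -> (2 * r <= (nrm (x - z)).+2)%N) ->
  (forall x y, x \in A -> y \in A -> ((nrm (x - y)).+1 <= q * r)%N) ->
  0 <= m ->
  (forall x, x \in A -> m <= \sum_(n : times K) heat (tot n) (x - z)) ->
  m ^+ 2 <= 2 ^+ N * @Cpair R d q * decay N r * denergy A nu * mean (fun w => (hits K A z w)%:R).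
Proof.
move=> KL r0 [nu0 nu1] zr xyr m0 mG.
have h1 : m <= mean (occ K A nu z).
  rewrite mean_occ // -[m]mul1r -nu1 mulr_suml !big_seq ler_sum // => x xA.
  by rewrite ler_wpM2l ?nu0 ?mG.
apply: le_trans (_ : mean (occ K A nu z) ^+ 2 <= _).
  by rewrite lerXn2r ?nnegrE // (le_trans m0).
have -> : mean (occ K A nu z) = mean (fun w => occ K A nu z w * (hits K A z w)%:R).
  by apply: eq_mean => w; rewrite occ_hits.
apply: le_trans (cauchy_schwarz _ _) _; rewrite mean_bool ler_wpM2r //.
  by apply: mean_ge0.
exact: second_moment.
Qed.

Lemma free_ofS {T : Type} (B B' : {set J}) (f : Om -> T) :
  {subset B' <= B} -> free_of B f -> free_of B' f.
Proof.
move=> BB fB w v; rewrite -(fB w (splice B' w v)); congr f.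
apply/ffunP => j; rewrite !ffunE; case: (boolP (j \in B')) => [/BB -> //|].
by case: (j \in B).
Qed.

(* The conditional expectation of [occ] given the past of [n] dominates the
   Green potential of [nu] at the current position. *)
Lemma potential_le_occ K (A : {fset Zd d}) nu z (n : times K) (f : Om -> R) :
  (K + K <= L)%N -> (forall x, x \in A -> 0 <= nu x) ->
  (forall w, 0 <= f w) -> free_of (future_upto N n) f ->
  mean (fun w => f w * \sum_(x <- A) nu x *
     \sum_(j : times K) heat (tot j) (x - (z + walk (past n) w))) <=
  mean (fun w => f w * occ (K + K) A nu z w).
Proof.
move=> KL nu0 f0 fn.
have jL (j : times K) i : (n i + j i <= L)%N.
  by apply: leq_trans KL; rewrite leq_add // -ltnS.
(* Restarting at time [n] runs the clocks up to [K + K], which is why the occupation on the right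
   side has twice the range. *)
pose sh (j : times K) : times (K + K) := [ffun i => inord (n i + j i)].
have shE j i : sh j i = (n i + j i)%N :> nat.
  by rewrite ffunE inordK // ltnS leq_add // -ltnS.
pose D (j : times K) : {set J} := past (sh j) :\: past n.
have cD j : #|D j| = tot j.
  transitivity (\sum_i (sh j i - n i))%N; last by apply: eq_bigr => i _; rewrite shE addKn.
  rewrite -card_slab => [|i]; last by rewrite shE.
  by apply: eq_card => k; rewrite !inE -leqNgt.
have DF j : {subset D j <= future_upto N n}.
  by move=> k; rewrite !inE -leqNgt => /andP[-> _]; rewrite ltn_ord.
have pF : free_of (future_upto N n) (walk (past n) : Om -> Zd d).
  by apply: walk_free => k; rewrite !inE ltn_ord /= -ltnNge.
have wsh j w : walk (past (sh j)) w = walk (past n) w + walk (D j) w.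
  rewrite (walkID _ (past n)); congr (walk _ w + _); apply/setP => k.
  rewrite !inE shE; apply/andP/idP => [[]//|h]; split => //.
  by rewrite ltn_addr.
have E : mean (fun w => f w * \sum_(x <- A) nu x *
     \sum_(j : times K) heat (tot j) (x - (z + walk (past n) w))) =
   mean (fun w => f w * \sum_(j : times K) \sum_(x <- A) nu x * dirac0 (walk (past (sh j)) w - (x - z))).
  transitivity (\sum_(x <- A) nu x * \sum_(j : times K)
      mean (fun w => f w * heat (tot j) (x - (z + walk (past n) w)))).
    transitivity (mean (fun w => \sum_(x <- A) nu x * \sum_(j : times K)
       f w * heat (tot j) (x - (z + walk (past n) w)))).
      apply: eq_mean => w; rewrite mulr_sumr; apply: eq_bigr => x _.
      by rewrite mulrCA mulr_sumr.
    by rewrite mean_sum; apply: eq_bigr => x _; rewrite mean_scale mean_sum.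
  transitivity (\sum_(x <- A) nu x * \sum_(j : times K)
      mean (fun w => f w * dirac0 (walk (past n) w + walk (D j) w - (x - z)))).
    apply: eq_bigr => x _; congr (_ * _); apply: eq_bigr => j _.
    rewrite mean_heat ?cD //; first exact: free_ofS (DF j) fn.
    exact: free_ofS (DF j) pF.
  transitivity (mean (fun w => \sum_(x <- A) nu x * \sum_(j : times K)
       f w * dirac0 (walk (past (sh j)) w - (x - z)))).
    rewrite mean_sum; apply: eq_bigr => x _; rewrite mean_scale mean_sum.
    congr (_ * _); apply: eq_bigr => j _; apply: eq_mean => w.
    by rewrite wsh.
  apply: eq_mean => w; rewrite exchange_big mulr_sumr; apply: eq_bigr => x _.
  by rewrite -!mulr_sumr mulrCA.
rewrite E; apply: mean_le => w; rewrite ler_wpM2l //.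
apply: (ler_sum_inj (A := predT) (B := predT) (h := sh) (F := fun m : times (K + K) =>
  \sum_(x <- A) nu x * dirac0 (walk (past m) w - (x - z)))) => //.
  move=> j j' _ _ /ffunP jj; apply/ffunP => i; apply: val_inj => /=.
  by have := congr1 (@nat_of_ord _) (jj i); rewrite !shE => /addnI.
move=> m; rewrite big_seq sumr_ge0 // => x xA.
by rewrite mulr_ge0 ?nu0 ?ler0n.
Qed.

Lemma hit_upper K (A : {fset Zd d}) z q r (c : R) : (K + K <= L)%N -> (0 < r)%N ->
  (forall x, x \in A -> (2 * r <= (nrm (x - z)).+2)%N) ->
  (forall x y, x \in A -> y \in A -> ((nrm (x - y)).+1 <= q * r)%N) ->
  0 <= c ->
  (forall x y, x \in A -> y \in A -> c * decay N (nrm (x - y)).+1 <=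
     \sum_(n : times K) heat (tot n) (x - y)) ->
  0 < mean (fun w => (hits K A z w)%:R) ->
  exists2 nu, probability_on A nu &
    c ^+ 2 * mean (fun w => (hits K A z w)%:R) * denergy A nu <=
    4 ^+ N * (2 ^+ N * @Cpair R d q * decay N r).
Proof.
have cancel (p e k C : R) : 0 < p -> 0 < e ->
    (p * (c * e)) ^+ 2 <= k * p * (C * e) -> c ^+ 2 * p * e <= k * C.
  move=> p0 e0 S; have pe : 0 < p * e by rewrite mulr_gt0.
  rewrite -(ler_pM2l pe).
  have -> : p * e * (c ^+ 2 * p * e) = (p * (c * e)) ^+ 2 by ring.
  by have -> : p * e * (k * C) = k * p * (C * e) by ring.
move=> KL r0 zr xyr c0 cG; set P := mean _ => P0.
pose T w : times K := odflt [ffun=> ord0] [pick n : times K | z + walk (past n) w \in A].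
have TP w : hits K A z w -> z + walk (past (T w)) w \in A.
  rewrite /T; case: pickP => //= h /existsP[n hn].
  by have := h n; rewrite /= hn.
pose X w := z + walk (past (T w)) w.
pose nu x := P^-1 * mean (fun w => (hits K A z w && (X w == x))%:R).
have nu0 x : 0 <= nu x.
  by apply: mulr_ge0; [rewrite invr_ge0 ltW|apply: mean_ge0].
have nuP x : P * nu x = mean (fun w => (hits K A z w && (X w == x))%:R).
  by rewrite mulrA mulfV ?mul1r ?gt_eqF.
have sumA (h : Zd d -> R) w : (hits K A z w)%:R * h (X w) =
    \sum_(x <- A) (hits K A z w && (X w == x))%:R * h x.
  case: (boolP (hits K A z w)) => hw; last by rewrite mul0r big1 // => x _; rewrite mul0r.
  rewrite (bigD1_seq (X w)) ?fset_uniq ?TP //= eqxx big1 ?addr0 // => x.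
  by rewrite eq_sym => /negPf ->; rewrite mul0r.
exists nu.
  split => [x _|]; first exact: nu0.
  apply: (mulfI (lt0r_neq0 P0)); rewrite mulr1 mulr_sumr.
  under eq_bigr do rewrite nuP.
  rewrite -mean_sum; apply: eq_mean => w.
  by have := sumA (fun=> 1) w; rewrite mulr1 => ->; apply: eq_bigr => x _; rewrite mulr1.
set C2 := 2 ^+ N * _ * _.
(* The final cancellation divides by [P * denergy A nu], so a nonpositive energy is settled
   separately. *)
have [E0|E0] := leP (denergy A nu) 0.
  apply: le_trans (_ : 0 <= _).
    by rewrite mulr_ge0_le0 // mulr_ge0 ?exprn_ge0 // ltW.
  rewrite mulr_ge0 ?exprn_ge0 // /C2 mulr_ge0 ?decay_ge0 // mulr_ge0 ?exprn_ge0 //.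
  exact: Cpair_ge0.
pose a (n : times K) w : R := (hits K A z w && (T w == n))%:R.
have a0 n w : 0 <= a n w by rewrite ler0n.
pose h y := \sum_(x <- A) nu x * \sum_(j : times K) heat (tot j) (x - y).
pose f n := avg (future_upto N n) (a n).
have f0 n w : 0 <= f n w by apply: avg_ge0.
have pF (n : times K) : free_of (future_upto N n) (walk (past n) : Om -> Zd d).
  by apply: walk_free => k; rewrite !inE ltn_ord /= -ltnNge.
have step1 : P * (c * denergy A nu) <= mean (fun w => (hits K A z w)%:R * h (X w)).
  rewrite (eq_mean (sumA h)) mean_sum.
  under eq_bigr do rewrite mean_scaler -nuP.
  rewrite /denergy exchange_big !mulr_sumr !big_seq ler_sum // => y yA.
  rewrite -mulrA ler_wpM2l ?(ltW P0) // /h !mulr_sumr !big_seq ler_sum // => x xA.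
  rewrite [leLHS](_ : _ = nu y * (nu x * (c * decay N (nrm (x - y)).+1))); last by ring.
  by rewrite !ler_wpM2l ?nu0 ?cG.
have step2 : mean (fun w => (hits K A z w)%:R * h (X w)) <=
    mean (fun w => (\sum_n f n w) * occ (K + K) A nu z w).
  have -> : mean (fun w => (hits K A z w)%:R * h (X w)) =
      \sum_n mean (fun w => a n w * h (z + walk (past n) w)).
    rewrite -mean_sum; apply: eq_mean => w.
    rewrite (bigD1 (T w)) //= /a eqxx andbT big1 ?addr0 // => n.
    by rewrite eq_sym => /negPf ->; rewrite andbF mul0r.
  rewrite [leRHS](_ : _ = \sum_n mean (fun w => f n w * occ (K + K) A nu z w)); last first.
    by rewrite -mean_sum; apply: eq_mean => w; rewrite mulr_suml.
  apply: ler_sum => n _.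
  have hF : free_of (future_upto N n) (fun w => h (z + walk (past n) w)).
    by move=> w v; rewrite pF.
  (* The position at time [n] depends on the past only, so the indicator [a n] may be replaced by
     its conditional expectation [f n]. *)
  have -> : mean (fun w => a n w * h (z + walk (past n) w)) = mean (fun w => f n w * h (z + walk (past n) w)).
    rewrite /f avg_adj; apply: eq_mean => w; congr (_ * _).
    by rewrite free_avg.
  by apply: potential_le_occ => //; apply: avg_free.
have step3 : mean (fun w => (\sum_n f n w) ^+ 2) <= 4 ^+ N * P.
  apply: le_trans (doob_times (leqnn N) a0) _; rewrite ler_wpM2l ?exprn_ge0 //.
  rewrite -[leRHS]mean_bool le_eqVlt; apply/orP; left; apply/eqP; apply: eq_mean => w.
  congr (_ ^+ 2); rewrite (bigD1 (T w)) //= /a eqxx andbT big1 ?addr0 // => n.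
  by rewrite eq_sym => /negPf ->; rewrite andbF.
have step4 : mean (fun w => occ (K + K) A nu z w ^+ 2) <= C2 * denergy A nu.
  exact: second_moment.
have F0 : 0 <= mean (fun w => (\sum_n f n w) ^+ 2) by apply: mean_ge0 => w; rewrite sqr_ge0.
have F1 : 0 <= mean (fun w => occ (K + K) A nu z w ^+ 2) by apply: mean_ge0 => w; rewrite sqr_ge0.
have : (P * (c * denergy A nu)) ^+ 2 <= 4 ^+ N * P * (C2 * denergy A nu).
  apply: le_trans (_ : mean (fun w => (\sum_n f n w) * occ (K + K) A nu z w) ^+ 2 <= _).
    have PE : 0 <= P * (c * denergy A nu).
      by apply: mulr_ge0; [exact: ltW|apply: mulr_ge0 => //; exact: ltW].
    rewrite lerXn2r ?nnegrE //; last exact: le_trans step1 step2.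
    exact: le_trans PE (le_trans step1 step2).
  apply: le_trans (cauchy_schwarz _ _) _.
  by apply: ler_pM.
apply: cancel => //.
Qed.

End HitModel.

(** * From the random walks to the finite model *)

Section Transfer.
Context {disp : measure_display} {T : measurableType disp} {R : realType}.
Variable P : probability T R.
Context {N d : nat}.
Hypothesis d_gt0 : (0 < d)%N.
Variable X : 'I_N -> nat -> T -> Zd d.
Hypothesis walksX : forall i, simple_random_walk P (X i).
Hypothesis indepX : independent_walks P X.
Local Notation times K := {ffun 'I_N -> 'I_K.+1}.

(** Over an arbitrary measurable space, because it serves both the ambient sigma-algebra and the one
    generated by a single walk, where independence of the walks is applied. *)
Lemma measurable_increment {disp' : measure_display} {T' : measurableType disp'}
    (Y : nat -> T' -> Zd d) k e :
  (forall n v, measurable (Y n @^-1` [set v])) ->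
  measurable (increment Y k @^-1` [set e]).
Proof.
move=> mY; have -> : increment Y k @^-1` [set e] =
    \bigcup_(v : Zd d) (Y k @^-1` [set v] `&` Y k.+1 @^-1` [set v + e]).
  apply/seteqP; split => t /=.
    by rewrite /increment => <-; exists (Y k t) => //=; rewrite addrC subrK.
  by case=> v _ [/= <- E]; rewrite /increment E addrC addKr.
apply: countable_bigcupT_measurable => [|v]; first exact: countableP.
exact: measurableI.
Qed.

Lemma prode_cst (I : choiceType) (J : {fset I}) (c : R) (f : I -> \bar R) :
  (forall i, i \in J -> f i = c%:E) -> (\prod_(i <- J) f i)%E = (c ^+ #|` J|)%:E.
Proof.
move=> fc; rewrite big_seq (eq_bigr (fun=> c%:E)) // -big_seq.
elim: (J : seq I) => [|x s IH]; first by rewrite big_nil.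
by rewrite big_cons IH -EFinM exprS.
Qed.

Lemma neighbour_vec e : neighbour (vec e : Zd d).
Proof. by case: e => i []; exists i; [right|left]. Qed.

Definition path_event i (J : {fset nat}) (e : nat -> dir d) : set T :=
  \bigcap_(k in [set` J]) (increment (X i) k @^-1` [set vec (e k)]).

Lemma path_event_prob i J e :
  P (path_event i J e) = (((2 * d)%:R^-1) ^+ #|` J|)%:E.
Proof.
have [mX X0 Xp Xi] := walksX i; rewrite (Xi J _).
  apply: prode_cst => k _; apply: Xp; exact: neighbour_vec.
move=> k _; apply: sub_sigma_algebra.
by exists tt, [set vec (e k)].
Qed.

Lemma path_event_sigma i J e : sigma_of (X i) (path_event i J e).
Proof.
rewrite /sigma_of; set G := (X in <<s X >>).
pose T' := g_sigma_algebraType G.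
suff : measurable (path_event i J e : set T') by [].
apply: fin_bigcap_measurable => // k _.
apply: (@measurable_increment _ T') => n v.
by apply: sub_sigma_algebra; exists n, [set v].
Qed.

Variable L : nat.
Local Notation Om := {ffun 'I_N * 'I_L.+1 -> dir d}.

Definition cyl (w : Om) : set T :=
  [set t | forall i k, increment (X i) (nat_of_ord k) t = vec (w (i, k))].

Lemma measurable_X i n (B : set (Zd d)) : measurable (X i n @^-1` B).
Proof. by have [mX _ _ _] := walksX i; apply: mX. Qed.

Lemma measurable_cyl w : measurable (cyl w).
Proof.
have -> : cyl w = \bigcap_(p in [set: 'I_N * 'I_L.+1])
   (increment (X p.1) p.2 @^-1` [set vec (w p)]).
  apply/seteqP; split => t /= h; first by move=> [i k] _; apply: h.
  by move=> i k; apply: (h (i, k)).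
apply: fin_bigcap_measurable => // p _; apply: measurable_increment => n v.
exact: measurable_X.
Qed.

Lemma prob_cyl w : P (cyl w) = ((((2 * d)%:R^-1) ^+ L.+1) ^+ N)%:E.
Proof.
pose JN : {fset 'I_N} := [fset i in enum 'I_N]%fset.
pose JL : {fset nat} := [fset k in iota 0 L.+1]%fset.
have cJN : #|` JN| = N.
  by rewrite card_fseq undup_id ?enum_uniq // size_enum_ord.
have cJL : #|` JL| = L.+1 by rewrite card_fseq undup_id ?iota_uniq // size_iota.
have mJN i : i \in JN by rewrite /JN inE /= mem_enum.
have mJL k : (k \in JL) = (k < L.+1)%N.
  by rewrite -[RHS]/(0 <= k < 0 + L.+1)%N -mem_iota; apply: in_fset.
pose E i := path_event i JL (fun k => w (i, inord k)).
have -> : cyl w = \bigcap_(i in [set` JN]) E i.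
  apply/seteqP; split => t /= h.
    move=> i _ k /=; rewrite mJL => kL.
    by have := h i (inord k); rewrite inordK.
  by move=> i k; have := h i (mJN i) k; rewrite /= mJL ltn_ord inord_val => /(_ isT).
transitivity (\prod_(i <- JN) P (E i))%E.
  by apply: indepX => i _; apply: path_event_sigma.
rewrite (prode_cst (c := (2 * d)%:R^-1 ^+ L.+1)) ?cJN // => i _.
by rewrite path_event_prob cJL.
Qed.

Lemma walk_on_cyl w t K (n : times K) : (K <= L.+1)%N -> cyl w t ->
  \sum_i X i (n i) t = walk (past n) w.
Proof.
move=> KL wt.
have nL i : (n i <= L.+1)%N by rewrite (leq_trans _ KL) // -ltnS.
have Xk i k : (k <= L.+1)%N -> X i k t = \sum_(l < L.+1 | (l < k)%N) vec (w (i, l)).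
  elim: k => [|k IH] kL; first by rewrite big_pred0 //; have [_ -> _ _] := walksX i.
  rewrite (bigD1 (Ordinal kL)) //= -(wt i (Ordinal kL)) /increment /=.
  rewrite (eq_bigl (fun l : 'I_L.+1 => (l < k)%N)) => [|l]; last first.
    by rewrite -(inj_eq val_inj) /= ltnS; lia.
  by rewrite -IH ?subrK // ltnW.
rewrite /walk (eq_bigl (fun j : 'I_N * 'I_L.+1 => xpredT j.1 && (j.2 < n j.1)%N)); last by move=> j; rewrite inE.
rewrite (eq_bigr (fun j => vec (w (j.1, j.2)))) => [|[i k] _ //].
rewrite -(pair_big_dep xpredT (fun i (k : 'I_L.+1) => (k < n i)%N) (fun i k => vec (w (i, k)))) /=.
by apply: eq_bigr => i _; rewrite Xk.
Qed.

Definition hit_event K (A : {fset Zd d}) z : set T :=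
  [set t | exists n : times K, z + \sum_i X i (n i) t \in A].

Lemma measurable_pos (n : 'I_N -> nat) v : measurable [set t | \sum_i X i (n i) t = v].
Proof.
have -> : [set t | \sum_i X i (n i) t = v] =
  \bigcup_(u : {ffun 'I_N -> Zd d}) (if \sum_i u i == v then
     \bigcap_(i in [set: 'I_N]) (X i (n i) @^-1` [set u i]) else set0).
  apply/seteqP; split => t /=.
    move=> <-; exists [ffun i => X i (n i) t] => //.
    under eq_bigr do rewrite ffunE.
    by rewrite eqxx => i _ /=; rewrite ffunE.
  move=> [u _]; case: eqP => // <- h; apply: eq_bigr => i _.
  exact: (h i).
apply: countable_bigcupT_measurable => [|u]; first exact: countableP.
case: ifP => // _; apply: fin_bigcap_measurable => // i _; exact: measurable_X.
Qed.

Lemma measurable_hit_event K A z : measurable (hit_event K A z).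
Proof.
have -> : hit_event K A z = \bigcup_(n : times K) \bigcup_(x in [set` A])
   [set t | \sum_i X i (n i) t = x - z].
  apply/seteqP; split => t /=.
    move=> [n hn]; exists n => //; exists (z + \sum_i X i (n i) t) => //=.
    by rewrite addrC addKr.
  by move=> [n _ [x xA /= E]]; exists n; rewrite E addrC subrK.
apply: fin_bigcup_measurable => // n _; apply: fin_bigcup_measurable => // x _.
exact: measurable_pos.
Qed.

Lemma prob_hit_event K A z : (K <= L.+1)%N ->
  P (hit_event K A z) = (mean (fun w : Om => (hits K A z w)%:R))%:E.
Proof.
move=> KL; set c : R := ((2 * d)%:R^-1 ^+ L.+1) ^+ N.
have cE : c = #|{: Om}|%:R^-1.
  rewrite card_ffun card_dir card_prod !card_ord natrX (mulnC N) exprM.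
  by rewrite /c !exprVn.
have triv (D : set Om) : trivIset D cyl.
  move=> w v _ _ [t [wt vt]]; apply/ffunP => -[i k].
  by apply: vec_inj; rewrite -(wt i k) -(vt i k).
have PD (p : pred Om) : P (\bigcup_(w in [set` p]) cyl w) = (\sum_(w | p w) c)%:E.
  rewrite measure_fin_bigcup //; last by move=> w _; apply: measurable_cyl.
  rewrite fsbig_finite // (eq_bigr (fun=> c%:E)) => [|w _]; last exact: prob_cyl.
  rewrite sumEFin -[in RHS]big_filter; congr (_%:E); apply: perm_big.
  apply: uniq_perm; rewrite ?filter_uniq ?index_enum_uniq ?fset_uniq // => w.
  by rewrite mem_filter mem_index_enum andbT in_fset_set // mem_setE.
(* The disjoint cylinders number [#|{: Om}|] and each has probability the inverse of this number, so
   the event that some increment up to the horizon is not a neighbour is null. *)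
have P1 : P (\bigcup_(w in [set` xpredT]) cyl w) = 1%E.
  rewrite PD sumr_const cE -[_ *+ _]mulr_natl mulfV //.
  exact: card_Om_neq0.
have mU (p : pred Om) : measurable (\bigcup_(w in [set` p]) cyl w).
  by apply: fin_bigcup_measurable => // w _; apply: measurable_cyl.
have -> : P (hit_event K A z) = (P (hit_event K A z `\` \bigcup_(w in [set` xpredT]) cyl w) +
    P (hit_event K A z `&` \bigcup_(w in [set` xpredT]) cyl w))%E.
  exact: measureDI (measurable_hit_event K A z) (mU xpredT).
have -> : P (hit_event K A z `\` \bigcup_(w in [set` xpredT]) cyl w) = 0%E.
  apply/eqP; rewrite eq_le measure_ge0 andbT.
  apply: (@le_trans _ _ (P (~` \bigcup_(w in [set` xpredT]) cyl w))).
    apply: le_measure; rewrite ?inE.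
    - by apply: measurableD => //; apply: measurable_hit_event.
    - exact: measurableC.
    - by move=> t [].
  by rewrite probability_setC // P1 subee.
rewrite add0e.
have -> : hit_event K A z `&` \bigcup_(w in [set` xpredT]) cyl w =
    \bigcup_(w in [set` (fun w => hits K A z w)]) cyl w.
  apply/seteqP; split => t.
    move=> [[n hn] [w _ wt]]; exists w => //=.
    by apply/existsP; exists n; rewrite -(walk_on_cyl n KL wt).
  move=> [w /= /existsP[n hn] wt]; split; last by exists w.
  by exists n; rewrite (walk_on_cyl n KL wt).
rewrite PD; congr (_%:E); rewrite cE sumr_const /mean.
rewrite -[_ *+ _]mulr_natr; congr (_ * _).
rewrite -sumr_const [LHS]big_mkcond; apply: eq_bigr => w _.
by rewrite -mulrb.
Qed.

End Transfer.

(** * Norms, energies and conclusion *)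

Section Geometry.
Context {R : realType} {d : nat}.
Hypothesis d_gt0 : (0 < d)%N.
Implicit Types (x y z : Zd d) (A : {fset Zd d}).
Local Notation enorm := (@enorm R d).

Let sq x : R := \sum_(i < d) (x ord0 i)%:~R ^+ 2.

Lemma sq_ge0 x : 0 <= sq x.
Proof. by apply: sumr_ge0 => i _; rewrite sqr_ge0. Qed.

Lemma enorm_ge0 x : 0 <= enorm x. Proof. exact: sqrtr_ge0. Qed.

Lemma sqr_enorm x : enorm x ^+ 2 = sq x.
Proof. by rewrite sqr_sqrtr ?sq_ge0. Qed.

Lemma enormD x y : enorm (x + y) <= enorm x + enorm y.
Proof.
pose p := \sum_(i < d) (x ord0 i)%:~R * (y ord0 i)%:~R : R.
have cs : p ^+ 2 <= sq x * sq y.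
  have q (s t : R) : 0 <= s ^+ 2 * sq x - 2 * s * t * p + t ^+ 2 * sq y.
    have -> : s ^+ 2 * sq x - 2 * s * t * p + t ^+ 2 * sq y =
        \sum_(i < d) (s * (x ord0 i)%:~R - t * (y ord0 i)%:~R) ^+ 2.
      rewrite /sq /p !mulr_sumr -sumrN -!big_split; apply: eq_bigr => i _ /=; ring.
    by apply: sumr_ge0 => i _; rewrite sqr_ge0.
  have [x0|x0] := eqVneq (sq x) 0.
    have := q (sq y + 1) p; rewrite x0 mul0r => h.
    have y0 := sq_ge0 y; have : p ^+ 2 * (sq y + 2) <= 0 by nra.
    by rewrite pmulr_lle0 //; lra.
  have xp : 0 < sq x by rewrite lt_def x0 sq_ge0.
  rewrite -(ler_pM2l xp) -subr_ge0.
  by have -> : sq x * (sq x * sq y) - sq x * p ^+ 2 = p ^+ 2 * sq x - 2 * p * sq x * p + sq x ^+ 2 * sq y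
    by ring.
have pe : p <= enorm x * enorm y.
  have [p0|p0] := leP p 0; first by rewrite (le_trans p0) // mulr_ge0 ?enorm_ge0.
  rewrite -(@ler_pXn2r _ 2) ?nnegrE ?(ltW p0) ?mulr_ge0 ?enorm_ge0 //.
  by rewrite exprMn !sqr_enorm.
rewrite -(@ler_pXn2r _ 2) ?nnegrE ?addr_ge0 ?enorm_ge0 //.
have -> : enorm (x + y) ^+ 2 = sq x + 2 * p + sq y.
  rewrite sqr_enorm /sq /p mulr_sumr -!big_split; apply: eq_bigr => i _ /=.
  by rewrite mxE intrD; ring.
rewrite sqrrD !sqr_enorm -mulr_natl; lra.
Qed.

Lemma enormN x : enorm (- x) = enorm x.
Proof.
by congr Num.sqrt; apply: eq_bigr => i _; rewrite mxE intrN sqrrN.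
Qed.

Lemma enorm_le_nrm x : enorm x <= (nrm x)%:R.
Proof.
rewrite -(@ler_pXn2r _ 2) ?nnegrE ?enorm_ge0 //.
rewrite sqr_enorm /sq /nrm natr_sum expr2 big_distrl /= ler_sum // => i _.
rewrite -real_normK ?num_real // -intr_norm -natr_absz expr2 ler_wpM2l //.
by rewrite (bigD1 i) //= lerDl sumr_ge0.
Qed.

Lemma nrm_le_enorm x : (nrm x)%:R <= d%:R * enorm x.
Proof.
have -> : d%:R * enorm x = \sum_(i < d) enorm x by rewrite sumr_const card_ord mulr_natl.
rewrite /nrm natr_sum ler_sum // => i _.
rewrite -(@ler_pXn2r _ 2) ?nnegrE ?enorm_ge0 // sqr_enorm natr_absz intr_norm.
rewrite real_normK ?num_real // /sq (bigD1 i) //= lerDl sumr_ge0 // => j _.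
by rewrite sqr_ge0.
Qed.

Lemma enorm_ge1 z : z != 0 -> 1 <= enorm z.
Proof.
move=> z0; rewrite -(@ler_pXn2r _ 2) ?nnegrE ?enorm_ge0 // expr1n sqr_enorm.
have /existsP[i zi] : [exists i, z ord0 i != 0].
  apply: contraNT z0 => /existsPn h; apply/eqP/rowP => i; rewrite mxE.
  by apply/eqP/negPn/h.
rewrite /sq (bigD1 i) //=; apply: ler_wpDr.
  by rewrite sumr_ge0 // => j _; rewrite sqr_ge0.
rewrite -real_normK ?num_real // -intr_norm -natr_absz -natrX ler1n expn_gt0.
by rewrite absz_gt0 zi.
Qed.

Lemma enorm_le_diam A x y : x \in A -> y \in A -> enorm (x - y) <= diam A.
Proof.
move=> xA yA; rewrite /diam.
apply: (@le_trans _ _ (\big[Num.max/0]_(y <- A) enorm (x - y))).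
  exact: (le_bigmax_seq 0 y xpredT (fun y => enorm (x - y))).
exact: (le_bigmax_seq 0 x xpredT (fun x => \big[Num.max/0]_(y <- A) enorm (x - y))).
Qed.

Variable N : nat.
Hypothesis Nd : (2 * N <= d)%N.
Local Notation g := (d - 2 * N)%N.

Lemma energy_kernel x : (1 + enorm x) `^ (- g%:R) = ((1 + enorm x) ^+ g)^-1.
Proof. by rewrite powRN powR_mulrn // addr_ge0 ?enorm_ge0. Qed.

Lemma denergy_le A nu : (forall x, x \in A -> 0 <= nu x) ->
  @denergy R d N A nu <= energy g%:R A nu.
Proof.
move=> nu0; rewrite /denergy /energy !big_seq ler_sum // => x xA.
rewrite !big_seq ler_sum // => y yA.
rewrite !ler_wpM2r ?nu0 // energy_kernel decayE //.
have e0 := enorm_ge0 (x - y).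
rewrite lef_pV2 ?posrE ?exprn_gt0 //; last by lra.
rewrite lerXn2r ?nnegrE //; first by lra.
by rewrite -natr1 addrC lerD2r enorm_le_nrm.
Qed.

Lemma energy_le A nu : (forall x, x \in A -> 0 <= nu x) ->
  energy g%:R A nu <= d%:R ^+ g * @denergy R d N A nu.
Proof.
move=> nu0; rewrite /denergy /energy mulr_sumr !big_seq ler_sum // => x xA.
rewrite mulr_sumr !big_seq ler_sum // => y yA.
rewrite decayE // !mulrA !ler_wpM2r ?nu0 // energy_kernel.
have e0 := enorm_ge0 (x - y).
have d1 : 1 <= d%:R :> R by rewrite ler1n.
have pe : 0 < (1 + enorm (x - y)) ^+ g by rewrite exprn_gt0 //; lra.
rewrite ler_pdivlMr ?exprn_gt0 ?ltr0n // mulrC ler_pdivrMr //.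
rewrite -exprMn lerXn2r ?nnegrE ?mulr_ge0 ?addr_ge0 //.
by rewrite mulrDr mulr1 -natr1 addrC lerD // nrm_le_enorm.
Qed.

End Geometry.

(** Distinct indices allow the clock of the head to be chosen without disturbing those of the
    tail. *)
Lemma in_minkowski_sum {V : nmodType} {I : eqType} (F : I -> nat -> V) (s : seq I) v :
  uniq s ->
  (\big[minkowski_sum/[set 0]]_(i <- s) range (F i)) v <->
  exists n : I -> nat, v = \sum_(i <- s) F i (n i).
Proof.
elim: s v => [|i s IH] v /= => [_|/andP[i_s us]].
  rewrite big_nil; split=> [/= ->|[n]]; first by exists (fun=> 0%N); rewrite big_nil.
  by rewrite big_nil.
rewrite big_cons; split.
  move=> [a [k _ <-] [b hb <-]]; have [n bE] := (IH b us).1 hb.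
  rewrite bE.
  exists (fun j => if j == i then k else n j); rewrite big_cons eqxx; congr (_ + _).
  apply: eq_big_seq => j js; case: eqP => // ji.
  by move: i_s; rewrite -ji js.
move=> [n ->]; rewrite big_cons; exists (F i (n i)); first by exists (n i).
by exists (\sum_(j <- s) F j (n j)) => //; apply/(IH _ us); exists n.
Qed.

Section HittingProbability.
Context {disp : measure_display} {T : measurableType disp} {R : realType}.
Variable P : probability T R.
Context {N d : nat}.
Hypothesis d_gt0 : (0 < d)%N.
Variable X : 'I_N -> nat -> T -> Zd d.
Hypothesis walksX : forall i, simple_random_walk P (X i).
Implicit Types (A : {fset Zd d}) (z : Zd d).

Lemma hit_bigcup A z :
  [set w | minkowski_sum [set z] (sum_of_ranges X w) `&` [set` A] !=set0] =
  \bigcup_K hit_event X K A z.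
Proof.
apply/seteqP; split => t /=.
  move=> [y [[a /= -> [v hv <-]] hA]].
  have [n vE] : exists n : 'I_N -> nat, v = \sum_i X i (n i) t.
    exact/(in_minkowski_sum (fun i n => X i n t) _ (index_enum_uniq _)).
  move: hA; rewrite vE => hA.
  have [K nK] : exists K, forall i, (n i <= K)%N.
    by exists (\max_i n i) => i; apply: leq_bigmax.
  exists K => //; exists [ffun i => inord (n i)].
  by under eq_bigr => i _ do rewrite ffunE inordK ?ltnS ?nK //.
move=> [K _ [n hA]]; exists (z + \sum_i X i (n i) t); split => //.
exists z => //; exists (\sum_i X i (n i) t) => //.
apply/(in_minkowski_sum (fun i n => X i n t) _ (index_enum_uniq _)).
by exists (fun i => n i).
Qed.

Lemma hit_event_mono A z : {homo (fun K => hit_event X K A z) : m n / (m <= n)%N >-> (m <= n)%O}.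
Proof.
move=> m n mn; apply/subsetPset => t [k hk]; exists [ffun i => inord (k i)].
have km i : (k i < n.+1)%N by rewrite ltnS (leq_trans _ mn) // -ltnS.
by under eq_bigr => i _ do rewrite ffunE inordK ?km //.
Qed.

Lemma hit_prob_le A z K : (P (hit_event X K A z) <= P (\bigcup_K hit_event X K A z))%E.
Proof.
apply: le_measure; rewrite ?inE; first exact: measurable_hit_event.
  by apply: bigcupT_measurable => k; apply: measurable_hit_event.
by move=> t ht; exists K.
Qed.

(** Continuity from below along the cutoffs; the bound is asked only for large [K], where the
    truncated Green function is bounded below. *)
Lemma hit_prob_lim A z K0 (b : \bar R) :
  (forall K, (K0 <= K)%N -> (P (hit_event X K A z) <= b)%E) ->
  (P (\bigcup_K hit_event X K A z) <= b)%E.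
Proof.
move=> hb; have mH k := measurable_hit_event walksX k A z.
have cv := nondecreasing_cvg_mu (mu := P) mH (bigcupT_measurable _ mH) (@hit_event_mono A z).
rewrite -(cvg_lim _ cv) //; apply: lime_le; first by apply/cvg_ex; eexists; exact: cv.
by exists K0 => // k /=; apply: hb.
Qed.

End HittingProbability.

Section Scales.
Context {R : realType} {d N : nat}.
Hypothesis d_gt0 : (0 < d)%N.
Hypothesis Nd : (2 * N < d)%N.
Local Notation enorm := (@enorm R d).
Local Notation g := (d - 2 * N)%N.
Local Notation decay := (@decay R d).
Variables (A : {fset Zd d}) (z : Zd d).
Hypothesis A0 : 0 \in A.
Hypothesis z0 : z != 0.
Hypothesis Az : 2 * diam A <= enorm z.
Implicit Types x y : Zd d.

(** A positive integer of order [enorm z]. For [x] in [A] one has [nrm (x - z) >= enorm z / 2 >= nrm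
    z / (2 * d)], and twice the scale must stay below this up to rounding; hence [4 * d]. *)
Definition scale : nat := (nrm z %/ (4 * d)).+1.

Lemma enorm_sub_le x y : x \in A -> y \in A -> enorm (x - y) <= enorm z / 2.
Proof.
move=> xA yA; rewrite ler_pdivlMr // mulrC (le_trans _ Az) // ler_wpM2l //.
exact: enorm_le_diam.
Qed.

Lemma enorm_le_half x : x \in A -> enorm x <= enorm z / 2.
Proof. by move=> xA; have := enorm_sub_le xA A0; rewrite subr0. Qed.

Lemma scale_far x : x \in A -> (2 * scale <= (nrm (x - z)).+2)%N.
Proof.
move=> xA; have d0 : 0 < d%:R :> R by rewrite ltr0n.
have h1 := enorm_le_half xA.
have h2 : enorm z <= enorm x + enorm (x - z).
  by have := @enormD R d x (- (x - z)); rewrite enormN opprB addrC subrK.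
have h3 := @enorm_le_nrm R d (x - z).
have h4 := @nrm_le_enorm R d z.
have h5 : (nrm z %/ (4 * d))%N%:R * (4 * d%:R) <= (nrm z)%:R :> R.
  by rewrite -!natrM ler_nat leq_trunc_div.
have h6 : (nrm z %/ (4 * d))%N%:R * 4 <= enorm z.
  by rewrite -(ler_pM2r d0) -mulrA [leRHS]mulrC (le_trans h5).
have : (2 * (nrm z %/ (4 * d)))%:R <= (nrm (x - z))%:R :> R by rewrite natrM; lra.
by rewrite ler_nat /scale; lia.
Qed.

(** [nrm (x - y)] is at most [d * nrm z / 2], and [nrm z < 4 * d * scale]; this gives [2 * d ^ 2],
    and the extra [1] covers the successor. *)
Lemma scale_close x y : x \in A -> y \in A ->
  ((nrm (x - y)).+1 <= (2 * d ^ 2 + 1) * scale)%N.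
Proof.
move=> xA yA; have h1 := enorm_sub_le xA yA.
have d0 : 0 < d%:R :> R by rewrite ltr0n.
have h2 := @nrm_le_enorm R d (x - y); have h3 := @enorm_le_nrm R d z.
have h4 : (nrm z < scale * (4 * d))%N by rewrite /scale ltn_ceil // muln_gt0 d_gt0.
have h5 : (2 * nrm (x - y))%:R <= (d * nrm z)%:R :> R.
  rewrite !natrM; have : d%:R * enorm (x - y) <= d%:R * (enorm z / 2) by rewrite ler_wpM2l.
  have : d%:R * enorm z <= d%:R * (nrm z)%:R by rewrite ler_wpM2l.
  lra.
rewrite ler_nat in h5.
have : (d * nrm z <= d * (scale * (4 * d)))%N by rewrite leq_mul2l ltnW ?orbT.
have : (0 < scale)%N by [].
by rewrite mulnDl mul1n expnS expn1; lia.
Qed.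

Lemma scale_decay : decay N scale <= (4 * d)%:R ^+ g / enorm z ^+ g.
Proof.
have e1 := @enorm_ge1 R d z z0; have e0 : 0 < enorm z by lra.
rewrite decayE ?(ltnW Nd) // ler_pdivlMr ?exprn_gt0 // mulrC ler_pdivrMr ?exprn_gt0 ?ltr0n //.
rewrite -exprMn lerXn2r ?nnegrE ?mulr_ge0 ?ler0n ?(ltW e0) //.
apply: le_trans (enorm_le_nrm z) _; rewrite -natrM ler_nat mulnC ltnW //.
by rewrite /scale ltn_ceil // muln_gt0 d_gt0.
Qed.

Lemma far_decay x : x \in A ->
  (((2 * d).+1%:R * enorm z) ^+ g)^-1 <= decay N (nrm (x - z)).+1.
Proof.
move=> xA; have e1 := @enorm_ge1 R d z z0; have e0 : 0 < enorm z by lra.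
have d1 : 1 <= d%:R :> R by rewrite ler1n.
rewrite decayE ?(ltnW Nd) // lef_pV2 ?posrE ?exprn_gt0 ?ltr0n ?mulr_gt0 //.
rewrite lerXn2r ?nnegrE ?mulr_ge0 ?ler0n ?(ltW e0) //.
have h1 := enorm_le_half xA; have h2 := @enormD R d x (- z); rewrite enormN in h2.
have h3 := @nrm_le_enorm R d (x - z).
(* This gives the [2 * d] of the statement; the remaining [1] is absorbed by [enorm z >= 1], where
   [z] being nonzero enters. *)
have h4 : d%:R * enorm (x - z) <= d%:R * (2 * enorm z) by rewrite ler_wpM2l //; lra.
rewrite -natr1 -[(2 * d).+1%:R]natr1 natrM mulrDl mul1r.
rewrite lerD // (le_trans h3) // (le_trans h4) // mulrCA mulrA; lra.
Qed.

End Scales.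

(** The point mass makes the set of energies nonempty and witnesses that hitting has positive
    probability. *)
Lemma delta_probability {R : realType} d (A : {fset Zd d}) : 0 \in A ->
  probability_on A (fun x => (x == 0)%:R : R).
Proof.
move=> A0; split=> [x _|]; first exact: ler0n.
rewrite (bigD1_seq 0) ?fset_uniq //= eqxx big1 ?addr0 // => x /negPf -> //.
Qed.

Theorem theorem1p6 (R : realType) (N d : nat)
    (hN : (1 <= N)%N) (hd : (1 + 2 * N <= d)%N) :
  exists2 C : R, 0 < C &
    forall (disp : measure_display) (T : measurableType disp)
      (P : probability T R) (X : 'I_N -> nat -> T -> Zd d),
    (forall i, simple_random_walk P (X i)) ->
    independent_walks P X ->
    forall (A : {fset Zd d}) (z : Zd d),
    0 \in A -> z != 0 -> 2 * diam A <= enorm z :> R ->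
    let bound : R :=
      capacity (d - 2 * N)%:R A / enorm z ^+ (d - 2 * N) in
    let hit : set T :=
      [set w | minkowski_sum [set z] (sum_of_ranges X w) `&` [set` A] !=set0] in
    ((C^-1 * bound)%:E <= P hit)%E /\ (P hit <= (C * bound)%:E)%E.
Proof.
have d_gt0 : (0 < d)%N by lia.
have Nd : (2 * N < d)%N by lia.
have [G [c [G0 c0 green]]] := @green_lower R d N d_gt0 hN.
pose g := (d - 2 * N)%N; pose q := (2 * d ^ 2 + 1)%N.
have [C2 C2E] : exists C2 : R, C2 = 2 ^+ N * @Cpair R d q + 1 by eexists.
have Cp0 : 0 <= 2 ^+ N * @Cpair R d q by rewrite mulr_ge0 ?exprn_ge0 ?Cpair_ge0.
have C20 : 0 < C2 by rewrite C2E; lra.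
have [a aE] : exists a : R, a = (4 * d)%:R ^+ g by eexists.
have [b bE] : exists b : R, b = (2 * d).+1%:R ^+ g by eexists.
have [h hE] : exists h : R, h = d%:R ^+ g by eexists.
have a0 : 0 < a by rewrite aE exprn_gt0 // ltr0n; lia.
have b0 : 0 < b by rewrite bE exprn_gt0 // ltr0n.
have h0 : 0 < h by rewrite hE exprn_gt0 // ltr0n.
(* Chosen so that [hit_lower] reads [k1 / D <= energy * p] and [hit_upper] gives
   [M * inf S <= k2 / D], with [D] the power of [enorm z]; [a], [b] and [h] come from comparing
   [nrm] with [enorm]. *)
pose k1 := c ^+ 2 / b ^+ 2 / (C2 * a).
pose k2 := 4 ^+ N * C2 * a * h / c ^+ 2.
have k10 : 0 < k1 by rewrite !divr_gt0 ?mulr_gt0 ?exprn_gt0.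
have k20 : 0 < k2 by rewrite divr_gt0 ?mulr_gt0 ?exprn_gt0.
exists (k1^-1 + k2); first by rewrite addr_gt0 ?invr_gt0.
move=> disp T P X walksX indepX A z A0 z0 Az bound hit.
have e1 := @enorm_ge1 R d z z0.
have [D DE] : exists D : R, D = enorm z ^+ g by eexists.
have D0 : 0 < D by rewrite DE exprn_gt0 //; lra.
pose S := [set energy g%:R A nu | nu in @probability_on R d A].
have SE : bound = (inf S)^-1 / D by rewrite DE.
(* One cutoff serves the lower Green bound both between points of [A] and from [z] to [A]. *)
have [K0 K0P] : exists K0 : nat, forall x y, x \in A -> y \in (z |` A)%fset ->
    (G * (nrm (x - y)).+1 ^ 2 <= K0)%N.
  pose s := \sum_(x <- (z |` A)%fset) nrm x.
  have xs x : x \in (z |` A)%fset -> (nrm x <= s)%N.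
    by move=> xA; rewrite /s (bigD1_seq x) ?fset_uniq //= leq_addr.
  exists (G * (s + s).+1 ^ 2)%N => x y xA yA.
  rewrite leq_mul2l leq_exp2r // ltnS (leq_trans (nrmB x y)) ?orbT //.
  by rewrite leq_add ?xs // in_fset1U xA orbT.
have in1 x : x \in A -> x \in (z |` A)%fset by move=> xA; rewrite in_fset1U xA orbT.
have zin : z \in (z |` A)%fset by rewrite in_fset1U eqxx.
pose r := scale z.
have r0 : (0 < r)%N by [].
have zr x : x \in A -> (2 * r <= (nrm (x - z)).+2)%N by exact: (scale_far d_gt0 Nd A0 z0 Az).
have xyr x y : x \in A -> y \in A -> ((nrm (x - y)).+1 <= q * r)%N.
  exact: (scale_close d_gt0 Nd A0 z0 Az).
have rD : @decay R d N r <= a / D by rewrite aE DE; apply: (scale_decay d_gt0 Nd z0).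
have EC : 2 ^+ N * @Cpair R d q <= C2 by rewrite C2E; lra.
rewrite /hit (hit_bigcup X A z) {hit}.
have mH : measurable (\bigcup_K hit_event X K A z).
  by apply: bigcupT_measurable => k; apply: measurable_hit_event.
have [p pE] : exists p : R, P (\bigcup_K hit_event X K A z) = p%:E.
  by exists (fine (P (\bigcup_K hit_event X K A z))); rewrite fineK ?fin_num_measure.
have p0 : 0 <= p by rewrite -lee_fin -pE.
have low nu : probability_on A nu -> k1 / D <= energy g%:R A nu * p.
  move=> nuP; have nu0 := nuP.1.
  pose m := c * (((2 * d).+1%:R * enorm z) ^+ g)^-1.
  have m0 : 0 <= m by rewrite mulr_ge0 ?invr_ge0 ?exprn_ge0 ?mulr_ge0 ?enorm_ge0 // ltW.
  have KL : (K0 <= (K0 + K0).+1)%N := leqW (leq_addr K0 K0).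
  have mG x : x \in A -> m <= \sum_(n : {ffun 'I_N -> 'I_K0.+1}) heat (tot n) (x - z).
    move=> xA; apply: le_trans (green K0 (x - z) (K0P x z xA zin)).
    by rewrite -mulrA ler_wpM2l ?(ltW c0) //; apply: (far_decay d_gt0 Nd A0 z0 Az xA).
  have HL := @hit_lower R d N (K0 + K0).+1 d_gt0 hN Nd K0 A nu z q r m KL r0 nuP zr xyr m0 mG.
  have := hit_prob_le walksX A z K0.
  rewrite pE (prob_hit_event d_gt0 walksX indepX A z KL) lee_fin => mp.
  have dE := denergy_le (ltnW Nd) nu0.
  have De0 : 0 <= @denergy R d N A nu.
    rewrite /denergy big_seq sumr_ge0 // => x xA; rewrite big_seq sumr_ge0 // => y yA.
    by rewrite mulr_ge0 ?nu0 // mulr_ge0 ?nu0 ?decay_ge0.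
  have dc0 := @decay_ge0 R d N r.
  have {HL} : m ^+ 2 <= C2 * (a / D) * energy g%:R A nu * p.
    apply: le_trans HL _; apply: ler_pM => //; first exact: mulr_ge0 (mulr_ge0 Cp0 dc0) De0.
      by apply: mean_ge0.
    apply: ler_pM => //; first exact: mulr_ge0.
    exact: ler_pM.
  have -> : m ^+ 2 = c ^+ 2 / b ^+ 2 / D ^+ 2.
    have -> : m = c * (b * D)^-1 by rewrite /m exprMn -bE -DE.
    by field; rewrite !gt_eqF.
  move=> HH; have aC : 0 < C2 * a by rewrite mulr_gt0.
  have := ler_wpM2r (ltW (divr_gt0 D0 aC)) HH.
  have -> : c ^+ 2 / b ^+ 2 / D ^+ 2 * (D / (C2 * a)) = k1 / D.
    by rewrite /k1; field; rewrite !gt_eqF.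
  have -> // : C2 * (a / D) * energy g%:R A nu * p * (D / (C2 * a)) = energy g%:R A nu * p.
  by field; rewrite !gt_eqF.
have kD : 0 < k1 / D by rewrite divr_gt0.
have nuD := @delta_probability R d A A0.
(* Positivity of [p] is what bounds the energies below by a positive number; otherwise [(inf S)^-1]
   might be the conventional inverse of [0]. *)
have pp : 0 < p.
  rewrite lt_def p0 andbT; apply: contraTneq (low _ nuD) => ->.
  by rewrite mulr0 -ltNge.
have lbS e : S e -> k1 / D / p <= e.
  by move=> [nu nuP <-]; rewrite ler_pdivrMr // low.
have eS : k1 / D / p <= inf S.
  apply: lb_le_inf => [|e]; last exact: lbS.
  by eexists; exists (fun x => (x == 0)%:R); first exact: nuD.
have i0 : 0 < inf S by apply: lt_le_trans eS; rewrite divr_gt0.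
have b00 : 0 <= bound by rewrite SE divr_ge0 ?invr_ge0 // ltW.
split.
  rewrite pE lee_fin; apply: (@le_trans _ _ (k1 * bound)).
    rewrite ler_wpM2r // -[leRHS]invrK lef_pV2 ?posrE ?addr_gt0 ?invr_gt0 //.
    by rewrite lerDl ltW.
  rewrite SE (_ : k1 * _ = k1 / D / inf S); last by field; rewrite !gt_eqF.
  by rewrite ler_pdivrMr // [leRHS]mulrC -ler_pdivrMr.
apply: (@hit_prob_lim _ _ _ _ _ _ _ walksX A z K0) => K K0K.
have KL : (K <= (K + K).+1)%N := leqW (leq_addr K K).
rewrite (prob_hit_event d_gt0 walksX indepX A z KL) lee_fin.
set M := mean _.
have M0 : 0 <= M by apply: mean_ge0.
have C0 : 0 <= k1^-1 + k2 by rewrite addr_ge0 ?invr_ge0 // ltW.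
(* The law of the visited point in [hit_upper] is conditioned on a hit, which must have positive
   probability. *)
have [M00|M1] := leP M 0; first by rewrite (le_trans M00) // mulr_ge0.
have Gxy x y : x \in A -> y \in A -> c * @decay R d N (nrm (x - y)).+1 <=
    \sum_(n : {ffun 'I_N -> 'I_K.+1}) heat (tot n) (x - y).
  move=> xA yA; apply: le_trans (green K (x - y) _); first by rewrite -mulrA.
  exact: leq_trans (K0P x y xA (in1 y yA)) K0K.
have KKL : (K + K <= (K + K).+1)%N := leqnSn _.
(* This [nu] depends on [K], but only [inf S <= energy] is retained of it, which keeps the final
   bound uniform in [K]. *)
have [nu nuP HU] := @hit_upper R d N (K + K).+1 d_gt0 hN Nd K A z q r c KKL r0 zr xyr (ltW c0) Gxy M1.
have nu0 := nuP.1.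
apply: (@le_trans _ _ (k2 * bound)); last by rewrite ler_wpM2r // lerDr invr_ge0 ltW.
rewrite SE (_ : k2 * _ = k2 / D / inf S); last by field; rewrite !gt_eqF.
rewrite ler_pdivlMr //.
have iE : inf S <= energy g%:R A nu.
  apply: ge_inf; last by exists nu.
  by exists (k1 / D / p) => e; apply: lbS.
have HE := energy_le d_gt0 (ltnW Nd) nu0.
have {HU} HU : c ^+ 2 * M * @denergy R d N A nu <= 4 ^+ N * (C2 * (a / D)).
  apply: le_trans HU _; rewrite ler_wpM2l ?exprn_ge0 //.
  by apply: ler_pM => //; apply: decay_ge0.
have c20 : 0 < c ^+ 2 by rewrite exprn_gt0.
apply: (@le_trans _ _ (M * (h * @denergy R d N A nu))).
  by rewrite ler_wpM2l // (le_trans iE) // hE.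
rewrite -(ler_pM2l c20).
have -> : c ^+ 2 * (M * (h * @denergy R d N A nu)) = h * (c ^+ 2 * M * @denergy R d N A nu) by ring.
apply: le_trans (ler_wpM2l (ltW h0) HU) _.
by rewrite le_eqVlt; apply/orP; left; apply/eqP; rewrite /k2; field; rewrite !gt_eqF.
Qed.
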